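(* Let $H\subset\mathcal{A}^{\mathbb{Z}}$ be a one-dimensional nearest-neighbor subshift of finite type over a finite alphabet $\mathcal{A}$ whose Rauzy graph $\mathcal{G}(H)$ does not satisfy condition D. Then for any two-dimensional subshift of finite type $Y\subset\mathcal{B}^{\mathbb{Z}^2}$ over a finite alphabet $\mathcal{B}$, there exists a one-dimensional subshift of finite type $V_Y\subset\mathcal{A}^{\mathbb{Z}}$ such that $X_{H,V_Y}$ is an $(m,n)$th root of $Y$ for some positive integers $m,n$. Furthermore, $m$, $n$ and $V_Y$ can be computed algorithmically (from descriptions of $H$ and $Y$ by finite sets of forbidden patterns).
   Context: For one-dimensional subshifts of finite type (SFTs) $H,V\subset\mathcal{A}^{\mathbb{Z}}$, the combined subshift is $$X_{H,V} := \{ x \in \mathcal{A}^{\mathbb{Z}^2} \mid \forall i, j \in \mathbb{Z},\ (x_{k,j})_{k \in \mathbb{Z}} \in H \text{ and } (x_{i,\ell})_{\ell \in \mathbb{Z}} \in V \}.$$ $H$ is nearest-neighbor if it is defined by a set of forbidden words of length $2$. Its Rauzy graph $\mathcal{G}(H)=(\mathcal{V},\vec{E})$ is the directed graph whose vertices are the letters appearing in configurations of $H$, with $(a,b)\in\vec{E}$ iff the word $ab$ appears in some configuration of $H$. The strongly connected components (SCCs) are the maximal sets of mutually reachable vertices; transient vertices (those with no nontrivial path to themselves) do not form SCCs. Condition D: the graph satisfies condition D if all its SCCs have a type in common among the following three (an SCC may have none, one or several types): - $S$ is of reflexive type if $(v,v)\in\vec{E}$ for all $v\in S$; - $S$ is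 of symmetric type if for all $v\neq w\in S$ with $(v,w)\in\vec{E}$ one has $(w,v)\in\vec{E}$; - $S$ is of state-split cycle type if there are $p\geq 1$ and a partition $S=\bigsqcup_{i=0}^{p-1}V_i$ such that for all $i$, all $v\in V_i$ and all $w\in S$: $(v,w)\in\vec{E}\Leftrightarrow w\in V_{i+1 \bmod p}$. Root: let $\sigma^{\vec v}(x)_{\vec k}=x_{\vec k-\vec v}$ be the shift. A subshift $X\subset\mathcal{A}^{\mathbb{Z}^2}$ is an $(m,n)$th root of a subshift $Y\subset\mathcal{B}^{\mathbb{Z}^2}$ if there exist a clopen set $Z\subset X$ with $\sigma^{(m,0)}(Z)=Z$ and $\sigma^{(0,n)}(Z)=Z$, and a homeomorphism $\varphi\colon Z\to Y$, such that $\varphi(\sigma^{(k_1m,k_2n)}(x))=\sigma^{(k_1,k_2)}(\varphi(x))$ for all $x\in Z$, $(k_1,k_2)\in\mathbb{Z}^2$, and $X = \bigsqcup_{0 \leq i < m,\, 0 \leq j < n} \sigma^{(i,j)}(Z)$ (disjoint union). *)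

(* Defs.v *)
From HB Require Import structures.
From Stdlib Require Import Relation_Operators.
From mathcomp Require Import all_boot all_order all_algebra.
From mathcomp Require Import boolp classical_sets functions cardinality topology.

Set Implicit Arguments.
Unset Strict Implicit.
Unset Printing Implicit Defensive.

Import GRing.Theory.
Local Open Scope classical_set_scope.
Local Open Scope ring_scope.

Definition conf2 (A : finType) : Type :=
  prod_topology (fun _ : int * int => discrete_topology A).
HB.instance Definition _ (A : finType) :=
  Topological.copy (conf2 A)
    (prod_topology (fun _ : int * int => discrete_topology A)).

Definition word_at (A : finType) (w : seq A) (x : int -> A) (i : int) : Prop :=
  mkseq (fun k => x (i + k%:Z)) (size w) = w.

Definition sft1 (A : finType) (F : seq (seq A)) : set (int -> A) :=
  [set x | forall w i, w \in F -> ~ word_at w x i].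

Definition is_sft1 (A : finType) (H : set (int -> A)) : Prop :=
  exists F : seq (seq A), H = sft1 F.

Definition length2 (A : finType) (F : seq (seq A)) : bool :=
  all (fun w => size w == 2%N) F.

Definition nearest_neighbor (A : finType) (H : set (int -> A)) : Prop :=
  exists2 F : seq (seq A), length2 F & H = sft1 F.

(* A finite pattern is given by the list of its (position, letter) pairs; a
   list that gives two letters to one position occurs nowhere. *)
Definition pattern (B : finType) := seq ((int * int) * B).

Definition pattern_at (B : finType) (p : pattern B) (y : conf2 B)
    (v : int * int) : Prop :=
  forall c, c \in p -> y (v + c.1) = c.2.

Definition sft2 (B : finType) (F : seq (pattern B)) : set (conf2 B) :=
  [set y | forall p v, p \in F -> ~ pattern_at p y v].

Definition is_sft2 (B : finType) (Y : set (conf2 B)) : Prop :=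
  exists F : seq (pattern B), Y = sft2 F.

Definition combined (A : finType) (H V : set (int -> A)) : set (conf2 A) :=
  [set x | forall i j : int,
     H (fun k => x (k, j)) /\ V (fun l => x (i, l))].

Definition rauzy_edge (A : finType) (H : set (int -> A)) (a b : A) : Prop :=
  exists2 x, H x & exists i, word_at [:: a; b] x i.

Section ConditionD.
Variables (A : finType) (E : A -> A -> Prop).

(* [clos_trans] is reachability by a path of length at least 1, so that a
   transient vertex belongs to no such set. *)
Definition mutually_reachable (S : set A) : Prop :=
  forall v w, S v -> S w -> clos_trans A E v w.

Definition scc (S : set A) : Prop :=
  [/\ S !=set0, mutually_reachable S &
      forall T, S `<=` T -> mutually_reachable T -> T = S].

Definition reflexive_type (S : set A) : Prop := forall v, S v -> E v v.

Definition symmetric_type (S : set A) : Prop :=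
  forall v w, S v -> S w -> v <> w -> E v w -> E w v.

(* [ordS i] is i + 1 mod p. *)
Definition state_split_cycle_type (S : set A) : Prop :=
  exists (p : nat) (V : 'I_p -> set A),
    [/\ (1 <= p)%N,
        [/\ forall i, V i !=set0, trivIset setT V & \bigcup_i V i = S] &
        forall i v w, V i v -> S w -> (E v w <-> V (ordS i) w)].

Definition condition_D : Prop :=
  [\/ forall S, scc S -> reflexive_type S,
      forall S, scc S -> symmetric_type S |
      forall S, scc S -> state_split_cycle_type S].

End ConditionD.

Definition shift2 (A : finType) (v : int * int) (x : conf2 A) : conf2 A :=
  fun k => x (k - v).

Definition homeomorphism (S T : topologicalType) (f : S -> T) : Prop :=
  continuous f /\
  exists g : T -> S, [/\ cancel f g, cancel g f & continuous g].

(* The subsets X, Y, Z carry the induced topology (that of [set_type]). In the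
   equivariance clause, x' is the element of Z underlying
   sigma^(k1 m, k2 n)(x). *)
Definition is_root (A B : finType) (m n : nat)
    (X : set (conf2 A)) (Y : set (conf2 B)) : Prop :=
  exists Z : set (conf2 A),
    [/\ Z `<=` X /\ clopen [set x : set_type X | Z (set_val x)],
        shift2 (m%:Z, 0) @` Z = Z /\ shift2 (0, n%:Z) @` Z = Z,
        exists phi : set_type Z -> set_type Y,
          homeomorphism phi /\
          forall (x x' : set_type Z) (k1 k2 : int),
            set_val x' = shift2 (k1 * m%:Z, k2 * n%:Z) (set_val x) ->
            set_val (phi x') = shift2 (k1, k2) (set_val (phi x)) &
        let T (ij : 'I_m * 'I_n) := shift2 (ij.1%:Z, ij.2%:Z) @` Z in
        X = \bigcup_ij T ij /\ trivIset setT T].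

(* Computability: Kleene's partial recursive functions of one variable, tuples
   being coded by the Cantor pairing function. *)
Definition npair (x y : nat) : nat := ('C((x + y).+1, 2) + y)%N.

Inductive recfun :=
  | RZero
  | RSucc
  | RLeft
  | RRight
  | RPair of recfun & recfun
  | RComp of recfun & recfun
  | RPrec of recfun & recfun
  | RMu of recfun.

(* [computes c x y]: the function coded by c is defined at x, with value y.
   Primitive recursion is h(a, 0) = f(a), h(a, i + 1) = g(a, (i, h(a, i))),
   witnessed by the sequence r of the values h(a, _). *)
Fixpoint computes (c : recfun) (x y : nat) : Prop :=
  match c with
  | RZero => y = 0%N
  | RSucc => y = x.+1
  | RLeft => exists z, x = npair y z
  | RRight => exists z, x = npair z y
  | RPair f g => exists u v, [/\ computes f x u, computes g x v & y = npair u v]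
  | RComp f g => exists2 z, computes g x z & computes f z y
  | RPrec f g => exists (a k : nat) (r : nat -> nat),
      [/\ x = npair a k, computes f a (r 0%N),
          forall i, (i < k)%N -> computes g (npair a (npair i (r i))) (r i.+1) &
          y = r k]
  | RMu f => computes f (npair x y) 0%N /\
      forall i, (i < y)%N -> exists v, computes f (npair x i) v.+1
  end.

Definition code_pair (S T : Type) (f : S -> nat) (g : T -> nat) (p : S * T) :
  nat := npair (f p.1) (g p.2).

Definition code_seq (T : Type) (f : T -> nat) (s : seq T) : nat :=
  foldr (fun t c => (npair (f t) c).+1) 0%N s.

Definition code_int (z : int) : nat :=
  match z with Posz k => k.*2 | Negz k => k.*2.+1 end.

Definition code_letter (A : finType) (a : A) : nat := enum_rank a.

Definition code_words (A : finType) (F : seq (seq A)) : nat :=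
  code_seq (code_seq (@code_letter A)) F.

Definition code_patterns (B : finType) (F : seq (pattern B)) : nat :=
  code_seq
    (code_seq (code_pair (code_pair code_int code_int) (@code_letter B))) F.

Definition code_input (A B : finType) (FH : seq (seq A))
    (FY : seq (pattern B)) : nat :=
  npair (npair #|A| (code_words FH)) (npair #|B| (code_patterns FY)).

Definition code_output (A : finType) (m n : nat) (FV : seq (seq A)) : nat :=
  npair m (npair n (code_words FV)).

(* Main.v *)
(* Fix a set of tiles: horizontal strips of 2R+1 letters of Y, where R bounds
   the positions in the forbidden patterns. A table F(r, i, t), with r < n,
   i < m and t a tile, describes the height-n block that a column of type i
   carrying the tile t shows. V_Y consists of the columns that are locally
   stacks of such blocks, of a single type, with tiles in which no forbidden
   pattern of Y occurs. X_{H,V_Y} is an (m,n)th root of Y as soon as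
   - two adjacent columns are compatible with H only if their types are
     i, i + 1 mod m and their blocks are at the same height, and
   - then the tiles are equal or, between type m - 1 and type 0, overlap.
   The readings of a column are unique because its neighbours see them.

   The rows of a table are closed walks of length m in the Rauzy graph. For the
   first condition one needs, for all i and j other than i + 1 mod m, a closed
   walk o with no edge from o_i to o_j: this is non-reflexivity for j = i,
   non-symmetry for j = i - 1, and otherwise its absence would make every walk
   of some length k > 1 shortcut by an edge, which forces the component to be a
   state-split cycle. A component that is not a state-split cycle also has
   edges e -> a, e -> a', a' -> b without an edge a -> b; running through
   the loops e a' b .. e and e a .. e in the two possible orders gives two
   closed walks o and f of the same length with no edge from f_i to o_(i+1).
   Rows that show f when the tile is t and o otherwise transmit the tile.
   Finally the rows are arranged in a cyclic order in which every pair of rows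
   occurs at every nonzero shift, so that shifted blocks are incompatible.

   The conditions on a table are decidable: an unbounded search finds one. *)

From Stdlib Require Import Relation_Operators.
Require Import Defs.
From mathcomp Require Import all_boot all_order all_algebra.
From mathcomp Require Import zify ring.

Set Implicit Arguments.
Unset Strict Implicit.
Unset Printing Implicit Defensive.

Import GRing.Theory.

(** * Arrangements in which every pair occurs at every shift *)

(** An increasing sequence of primes. It starts at 3 so that modulo each of them some nonzero
    residue differs from any one given residue. *)
Fixpoint coprime_moduli (i : nat) : nat :=
  if i is j.+1 then s2val (prime_above (coprime_moduli j)) else 3.

Lemma coprime_moduli_prime i : prime (coprime_moduli i).
Proof. by case: i => [|i] //=; case: (prime_above _). Qed.

Lemma coprime_moduli_lt i j : i < j -> coprime_moduli i < coprime_moduli j.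
Proof.
elim: j => // j IH; rewrite ltnS leq_eqVlt => /orP[/eqP->|/IH hij] /=.
  by case: (prime_above _).
by apply: ltn_trans hij _; case: (prime_above _).
Qed.

Lemma coprime_moduli_ge3 i : 2 < coprime_moduli i.
Proof. by case: i => [|i] //; apply: ltnW (@coprime_moduli_lt 0 i.+1 _). Qed.

Lemma coprime_moduliP i j : i != j ->
  coprime (coprime_moduli i) (coprime_moduli j).
Proof.
move=> ij; rewrite prime_coprime ?coprime_moduli_prime //.
rewrite dvdn_prime2 ?coprime_moduli_prime //.
by case: (ltngtP i j) ij => // /coprime_moduli_lt; rewrite ?ltn_neqAle;
  case/andP => h _ _; rewrite // eq_sym.
Qed.

Local Notation moduli_prod N := (\prod_(i < N) coprime_moduli i).

Lemma coprime_moduli_prod N : coprime (moduli_prod N) (coprime_moduli N).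
Proof.
apply: (big_ind (fun x => coprime x (coprime_moduli N))) => [|x y hx hy|i _].
- by rewrite coprime1n.
- by rewrite coprimeMl hx.
- by apply: coprime_moduliP; rewrite neq_ltn ltn_ord.
Qed.

Lemma chinese_moduli N (a : nat -> nat) :
  exists r, forall i, i < N -> r = a i %[mod coprime_moduli i].
Proof.
elim: N => [|N [r IH]]; first by exists 0.
exists (chinese (moduli_prod N) (coprime_moduli N) r (a N)) => i.
have co := coprime_moduli_prod N.
rewrite ltnS leq_eqVlt => /orP[/eqP->|iN]; first by rewrite chinese_modr.
rewrite -(IH i iN).
have d : coprime_moduli i %| moduli_prod N.
  by rewrite (bigD1 (Ordinal iN)) //= dvdn_mulr.
by rewrite -(modn_dvdm _ d) chinese_modl // modn_dvdm.
Qed.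

Lemma moduli_prod_dvd N x :
  (forall i, i < N -> coprime_moduli i %| x) -> moduli_prod N %| x.
Proof.
elim: N => [|N IH] h; first by rewrite big_ord0 dvd1n.
rewrite big_ord_recr /= Gauss_dvd ?coprime_moduli_prod // h // andbT.
by apply: IH => i iN; apply: h; apply: ltnW.
Qed.

Lemma moduli_dvd_prod N i : i < N -> coprime_moduli i %| moduli_prod N.
Proof. by move=> iN; rewrite (bigD1 (Ordinal iN)) //= dvdn_mulr. Qed.

Lemma subset_of_card (T : finType) (J : {set T}) k :
  k <= #|J| -> exists2 X : {set T}, X \subset J & #|X| = k.
Proof.
move=> kJ; exists [set x in take k (enum J)].
  by apply/subsetP => x; rewrite inE => /mem_take; rewrite mem_enum.
rewrite cardsE (card_uniqP _) ?take_uniq ?enum_uniq // size_takel //.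
by rewrite -cardE.
Qed.

(* The divisibility of r and r + psi by the moduli can be prescribed
   independently, except that a modulus dividing psi divides both or none. *)
Lemma moduli_prescribe N psi (X Y C : {set 'I_N}) :
    (forall i, i \in X -> ~~ (coprime_moduli i %| psi)) ->
    (forall i, i \in Y -> ~~ (coprime_moduli i %| psi)) ->
    (forall i, i \in C -> coprime_moduli i %| psi) ->
    [disjoint X & Y] ->
  exists r, forall i : 'I_N,
    (coprime_moduli i %| r) = (i \in X :|: C) /\
    (coprime_moduli i %| r + psi) = (i \in Y :|: C).
Proof.
move=> hX hY hC dXY.
(* Modulo [q], the value [(q - 1) * psi] is [- psi], which makes [r + psi] divisible but not [r].
   Outside [X], [Y] and [C] the residue is 1, or 2 when 1 is [- psi]. The last 0 is a default for
   indices beyond [N]. *)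
pose a (i : nat) : nat := if insub i is Some j then
  if j \in X :|: C then 0
  else if j \in Y then (coprime_moduli j).-1 * psi
  else if coprime_moduli j %| 1 + psi then 2 else 1 else 0.
have [r hr] := chinese_moduli N a; exists r => i.
have q3 := coprime_moduli_ge3 i.
have hri := hr i (ltn_ord i).
have -> : (coprime_moduli i %| r) = (coprime_moduli i %| a i) by rewrite /dvdn hri.
have -> : (coprime_moduli i %| r + psi) = (coprime_moduli i %| a i + psi).
  by rewrite /dvdn -modnDml hri modnDml.
have ai : a i = if i \in X :|: C then 0 else if i \in Y
    then (coprime_moduli i).-1 * psi
    else if coprime_moduli i %| 1 + psi then 2 else 1 by rewrite /a valK.
rewrite ai; rewrite !inE; case: (boolP (i \in X)) => iX /=.
  rewrite dvdn0 add0n; split => //.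
  have -> : (i \in Y) = false.
    by apply/negbTE; move: dXY; rewrite disjoint_subset => /subsetP/(_ _ iX).
  rewrite (negbTE (hX _ iX)) /=; apply/esym/negbTE.
  by apply: contra (hX _ iX) => /hC.
case: (boolP (i \in C)) => iC /=.
  by rewrite dvdn0 add0n hC // orbT.
case: (boolP (i \in Y)) => iY /=.
  split.
    apply/negbTE; rewrite Gauss_dvdr ?hY //.
    by rewrite coprime_sym coprimePn //; lia.
  have -> : (coprime_moduli i).-1 * psi + psi = coprime_moduli i * psi.
    by rewrite -mulSnr prednK //; lia.
  by rewrite dvdn_mulr.
case: ifP => h.
  split; first by apply/negbTE/negP => /dvdn_leq; lia.
  apply/negbTE/negP; rewrite -[2]/(1 + 1) -addnA dvdn_addl //.
  by move=> /dvdn_leq; lia.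
by split => //; apply/negbTE/negP => /dvdn_leq; lia.
Qed.

(** All pairs are written one after the other in a single list, so each of them occupies two
    consecutive places. *)
Lemma adjacent_pairs (K : finType) (k0 : K) : exists (h : nat -> K) (M : nat),
  forall f g, exists c, [/\ c < M, h c = f & h c.+1 = g].
Proof.
pose s := flatten [seq [:: p.1; p.2] | p <- enum {: K * K}].
exists (nth k0 s), (size s) => f g.
rewrite /s; have : (f, g) \in enum {: K * K} by rewrite mem_enum.
elim: (enum _) => //= p l IH; rewrite inE => /orP[/eqP<-|/IH[c [cs h1 h2]]].
  by exists 0.
by exists c.+2.
Qed.

(* r is labelled by the number of moduli that divide it; when psi is not a
   multiple of all the moduli, enough pairs of such numbers are attained. *)
Lemma all_pairs_at_all_shifts (K : finType) (k0 : K) :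
  exists (n : nat) (w : nat -> K), [/\ 1 < n,
    forall r, w (r %% n) = w r &
    forall psi, 0 < psi < n -> forall f g,
      exists r, [/\ r < n, w r = f & w (r + psi) = g]].
Proof.
have [h [M hM]] := adjacent_pairs k0.
have M0 : 0 < M by case: (hM k0 k0) => c [cM _ _]; lia.
pose N := 3 * M.
pose wt r := #|[set i : 'I_N | coprime_moduli i %| r]|.
have n1 : 1 < moduli_prod N.
  have N0 : 0 < N by lia.
  have /dvdn_leq := moduli_dvd_prod N0; rewrite prodn_gt0 ?coprime_moduli_ge3 //.
    by move=> /(_ isT); apply: leq_trans.
  by move=> i; have := coprime_moduli_ge3 i; lia.
have wtm r : wt (r %% moduli_prod N) = wt r.
  apply: eq_card => i; rewrite !inE; congr (_ == _).
  by rewrite modn_dvdm // moduli_dvd_prod.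
exists (moduli_prod N), (fun r => h (wt r)); split=> //; first by move=> r; rewrite wtm.
move=> psi psin f g.
suff [r [h1 h2]] : exists r, h (wt r) = f /\ h (wt (r + psi)) = g.
  exists (r %% moduli_prod N); rewrite ltn_mod wtm.
  by rewrite -[wt (_ + _)]wtm modnDml wtm; split=> //; lia.
pose J := [set i : 'I_N | ~~ (coprime_moduli i %| psi)].
have J0 : 0 < #|J|.
  rewrite card_gt0; apply/eqP => J0.
  have /moduli_prod_dvd /dvdn_leq : forall i, i < N -> coprime_moduli i %| psi.
    move=> i iN; have : Ordinal iN \notin J by rewrite J0 inE.
    by rewrite inE negbK.
  lia.
have wtE r (X : {set 'I_N}) : (forall i : 'I_N, (coprime_moduli i %| r) = (i \in X)) ->
    wt r = #|X|.
  by move=> hX; apply: eq_card => i; rewrite inE hX.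
have cJ : #|J| + #|~: J| = N by rewrite cardsC card_ord.
have {cJ} : exists2 u, #|J| = u & exists2 v, #|~: J| = v & u + v = 3 * M.
  by exists #|J| => //; exists #|~: J|.
move=> [u uJ [v vJ uv]].
(* Of the moduli dividing [psi], [c] are made to divide both numbers, and one other modulus [i0]
   divides only [r + psi]: the counts are [c] and [c + 1], where [h] takes the values [f] and
   [g]. *)
case: (leqP M v) => sJ.
  have [c [cM hc1 hc2]] := hM f g.
  have [C /subsetP CJ cC] : exists2 C : {set 'I_N}, C \subset ~: J & #|C| = c.
    by apply: subset_of_card; rewrite vJ; lia.
  have [i0 i0J] : exists i0, i0 \in J by apply/set0Pn; rewrite -card_gt0.
  have i0C : i0 \notin C by apply/negP => /CJ; rewrite inE i0J.
  have [r hr] := @moduli_prescribe N psi set0 [set i0] C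
    (fun i => ltac:(by rewrite inE))
    (fun i => ltac:(by move/set1P => ->; rewrite inE in i0J))
    (fun i => ltac:(by move/CJ; rewrite !inE negbK)) ltac:(by rewrite disjoints_subset sub0set).
  exists r; rewrite (wtE r (set0 :|: C)) => [|i]; last by case: (hr i).
  rewrite (wtE _ ([set i0] :|: C)) => [|i]; last by case: (hr i).
  by rewrite set0U cardsU1 i0C cC.
(* More than [2 * M] moduli do not divide [psi]: two disjoint sets of them, of any sizes below [M],
   can be made the divisors of [r] and of [r + psi]. *)
have [al [alM ha _]] := hM f f; have [be [beM hb _]] := hM g g.
have [X XJ cX] : exists2 X : {set 'I_N}, X \subset J & #|X| = al.
  by apply: subset_of_card; rewrite uJ; lia.
have cJX : #|J :\: X| = #|J| - al by rewrite cardsD (setIidPr XJ) cX.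
have [Y /subsetP YJ cY] : exists2 Y : {set 'I_N}, Y \subset J :\: X & #|Y| = be.
  by apply: subset_of_card; rewrite cJX uJ; lia.
have [r hr] := @moduli_prescribe N psi X Y set0
    (fun i => ltac:(by move/(subsetP XJ); rewrite inE))
    (fun i => ltac:(by move/YJ; rewrite !inE => /andP[]))
    (fun i => ltac:(by rewrite inE))
    ltac:(by rewrite disjoint_sym disjoint_subset; apply/subsetP => i /YJ; rewrite !inE => /andP[]).
exists r; rewrite (wtE r (X :|: set0)) => [|i]; last by case: (hr i).
rewrite (wtE _ (Y :|: set0)) => [|i]; last by case: (hr i).
by rewrite !setU0 cX cY.
Qed.

From mathcomp Require Import boolp classical_sets functions cardinality topology.

(** * Walks in a finite directed graph *)

Section Walks.
Variables (A : finType) (E : rel A).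

Fixpoint walk (k : nat) (a b : A) : bool :=
  if k is l.+1 then [exists c, E a c && walk l c b] else a == b.

Lemma walk_cons k a b c : E a b -> walk k b c -> walk k.+1 a c.
Proof. by move=> ab bc; apply/existsP; exists b; rewrite ab. Qed.

Lemma walk_uncons k a c : walk k.+1 a c -> exists2 b, E a b & walk k b c.
Proof. by move=> /existsP[b /andP[]]; exists b. Qed.

Lemma walk1 a b : walk 1 a b = E a b.
Proof.
apply/idP/idP => [/walk_uncons[c ac /eqP<-]//|ab].
by apply: walk_cons ab _ => /=.
Qed.

Lemma walk_cat k l a b c : walk k a b -> walk l b c -> walk (k + l) a c.
Proof.
elim: k a => [|k IH] a; first by move=> /eqP->.
by move=> /walk_uncons[d ad db] /(IH _ db); apply: walk_cons.
Qed.

Lemma walk_split k l a c : walk (k + l) a c ->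
  exists2 b, walk k a b & walk l b c.
Proof.
elim: k a => [|k IH] a; first by exists a => /=.
by move=> /walk_uncons[d ad /IH[b db bc]]; exists b => //; apply: walk_cons db.
Qed.

Lemma walk_rcons k a b c : walk k a b -> E b c -> walk k.+1 a c.
Proof. by move=> ab bc; rewrite -addn1; apply: walk_cat ab _; rewrite walk1. Qed.

Lemma walk_unrcons k a c : walk k.+1 a c -> exists2 b, walk k a b & E b c.
Proof. by rewrite -addn1 => /walk_split[b ab]; rewrite walk1; exists b. Qed.

Lemma walk_iter n k a : walk k a a -> walk (n * k) a a.
Proof.
move=> aa; elim: n => [|n IH]; first by rewrite mul0n /=.
by rewrite mulSn; apply: walk_cat IH.
Qed.

Lemma clos_trans_walk a b : clos_trans A E a b <-> exists k, walk k.+1 a b.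
Proof.
split.
  elim=> [x y xy|x y z _ [k xy] _ [l yz]]; first by exists 0; rewrite walk1.
  by exists (k + l.+1); rewrite -addSn; apply: walk_cat yz.
move=> [k]; elim: k a => [|k IH] a; first by rewrite walk1; apply: t_step.
by move=> /walk_uncons[c ac /IH]; apply: t_trans; apply: t_step.
Qed.

(** There are finitely many Boolean matrices of [k]-step reachability, so two of them coincide, and
    the sequence is periodic from the first one on. *)
Lemma walk_eventually_periodic : exists N q, 0 < q /\
  forall k c a b, N <= k -> walk (k + c * q) a b = walk k a b.
Proof.
pose W k : {ffun A * A -> bool} := [ffun p => walk k p.1 p.2].
have : ~~ injectiveb (fun i : 'I_#|{ffun A * A -> bool}|.+1 => W i).
  by apply/negP => /injectiveP /leq_card; rewrite card_ord ltnn.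
move=> /injectivePn[i [j ij Wij]].
wlog lt_ij : i j ij Wij / i < j => [hw|].
  case: (ltngtP i j) => h; first exact: hw h.
    by apply: hw h => //; rewrite eq_sym.
  by rewrite (val_inj h) eqxx in ij.
have Wk k a b : walk (i + k) a b = walk (j + k) a b.
  have h c : walk i a c = walk j a c.
    by have := congr1 (fun f : {ffun _} => f (a, c)) Wij; rewrite !ffunE.
  by apply/idP/idP => /walk_split[c]; rewrite ?h -?h => ac cb; apply: walk_cat cb;
    rewrite ?h // -h.
exists i, (j - i); split; first by lia.
move=> k c a b ik; elim: c => [|c IH]; first by rewrite mul0n addn0.
rewrite -IH mulSn -(subnK ik) -addnA [_ + (i + _)]addnC -addnA.
have -> : i + (j - i + c * (j - i) + (k - i)) = j + (c * (j - i) + (k - i)) by lia.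
by rewrite -Wk; congr walk; lia.
Qed.

(** * Walks as sequences of vertices, and closed walks *)

Definition wfun k a b (f : nat -> A) :=
  [/\ f 0 = a, f k = b & forall i, i < k -> E (f i) (f i.+1)].

Definition fcat k (f g : nat -> A) i := if i < k then f i else g (i - k).

Lemma wfun_cat k l a b c f g :
  wfun k a b f -> wfun l b c g -> wfun (k + l) a c (fcat k f g).
Proof.
move=> [f0 fk fE] [g0 gl gE]; split; rewrite /fcat.
- by case: k fk {fE} => [|k] fk //=; rewrite g0 -fk.
- by rewrite ltnNge leq_addr addKn.
- move=> i ikl; case: (ltngtP i.+1 k) => h.
  + by apply: fE; lia.
  + by have -> : i.+1 - k = (i - k).+1 by [lia]; apply: gE; lia.
  + by rewrite -h subnn g0 -fk -h; apply: fE; rewrite h.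
Qed.

Lemma walkP k a b : walk k a b -> exists f, wfun k a b f.
Proof.
elim: k a => [|k IH] a; first by move=> /eqP->; exists (fun=> b).
move=> /walk_uncons[c ac /IH[f [f0 fk fE]]].
exists (fun i => if i is j.+1 then f j else a); split=> // -[|i] ik.
  by rewrite f0.
by apply: fE.
Qed.

Lemma wfun_walk k a b f i j : wfun k a b f -> i <= j <= k ->
  walk (j - i) (f i) (f j).
Proof.
move=> [_ _ fE] /andP[ij jk]; elim: j ij jk => [|j IH] ij jk.
  by move: ij; rewrite leqn0 => /eqP->; rewrite subnn /=.
move: ij; rewrite leq_eqVlt => /orP[/eqP->|ij]; first by rewrite subnn /=.
by rewrite subSn //; apply: walk_rcons (fE _ jk); apply: IH => //; lia.
Qed.

Lemma modnS_mod m i : i.+1 %% m = (i %% m).+1 %% m.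
Proof. by rewrite -addn1 -modnDml addn1. Qed.

Definition closed_walk m (o : nat -> A) :=
  forall i, i < m -> E (o i) (o (i.+1 %% m)).

Lemma wfun_closed m a f : wfun m a a f -> closed_walk m f.
Proof.
move=> [f0 fm fE] i im; case: (ltngtP i.+1 m) => h; last 1 first.
- by rewrite h modnn f0 -{1}fm -h; apply: fE; rewrite h.
- by rewrite modn_small // fE.
- by lia.
Qed.

Lemma closed_walk_rot m s o : 0 < m -> closed_walk m o ->
  closed_walk m (fun j => o ((j + s) %% m)).
Proof.
move=> m0 h i im; rewrite modnDml addSn modnS_mod.
by apply: h; rewrite ltn_mod.
Qed.

Lemma closed_walk_cyclic m o i : i < m -> closed_walk m o ->
  exists k, walk k.+1 (o i) (o i).
Proof.
move=> im h; exists m.-1; rewrite prednK; last by lia.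
suff H k : walk k (o i) (o ((i + k) %% m)).
  by have := H m; rewrite modnDr modn_small.
elim: k => [|k IH]; first by rewrite addn0 modn_small //=.
apply: walk_rcons IH _; rewrite addnS modnS_mod.
by apply: h; rewrite ltn_mod; lia.
Qed.

(** * Deterministic components and state-split cycles *)

Section Component.
Variable S : set A.
Hypothesis S_conn : forall x y, S x -> S y -> exists k, walk k.+1 x y.
Hypothesis S_closed : forall x y u k l,
  S x -> S y -> walk k x u -> walk l u y -> S u.

(** The local form of being a state-split cycle; [forward_det_state_split] recovers the blocks from
    it. *)
Definition forward_det := forall e a a' b, S e -> S a -> S a' -> S b ->
  E e a -> E e a' -> E a b -> E a' b.

Definition backward_det := forall e a a' b, S e -> S a -> S a' -> S b ->
  E a e -> E a' e -> E b a -> E b a'.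

Lemma S_succ x y u : S x -> S y -> E x u -> (exists k, walk k u y) -> S u.
Proof.
by move=> Sx Sy xu [k uy]; apply: (@S_closed x y u 1 k) => //; rewrite walk1.
Qed.

Lemma S_pred x y u k : S x -> S y -> walk k x u -> E u y -> S u.
Proof.
by move=> Sx Sy xu uy; apply: (@S_closed x y u k 1) => //; rewrite walk1.
Qed.

(** By backward determinism, two vertices that reach [e] in equally many steps have the same
    predecessors. This applies to [b] and a successor [x] of [a'], thanks to the loops at [e]
    through [a] and through [a']. *)
Lemma backward_det_forward : backward_det -> forward_det.
Proof.
move=> bd; have aux k x y e b : S x -> S y -> S e -> S b ->
    walk k x e -> walk k y e -> E b x -> E b y.
  elim: k x y b => [|k IH] x y b Sx Sy Se Sb; first by move=> /eqP-> /eqP->.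
  move=> /walk_uncons[x1 xx1 x1e] /walk_uncons[y1 yy1 y1e] bx.
  have Sx1 : S x1 by apply: (S_succ Sx Se xx1); exists k.
  have Sy1 : S y1 by apply: (S_succ Sy Se yy1); exists k.
  have xy1 : E x y1 by apply: IH xx1.
  by apply: (bd y1 x).
move=> e a a' b Se Sa Sa' Sb ea ea' ab.
have [d1 be] := S_conn Sb Se; have [d2 a'e] := S_conn Sa' Se.
have [x a'x xe] := walk_uncons a'e.
have Sx : S x by apply: (S_succ Sa' Se a'x); exists d2.
apply: (aux (d1.+1 + d2.+2) x b e) => //.
  have -> : d1.+1 + d2.+2 = d2 + d1.+3 by lia.
  by apply: walk_cat xe _; apply: walk_cons ea _; apply: walk_cons ab _.
by apply: walk_cat be _; apply: walk_cons ea' _.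
Qed.

(** Repeated shortcuts turn every walk of length [k * (j - 1) + 1] into an edge. Turning around a
    loop through [a'] and [e] often enough gives a walk of such a length from [a'] to [b]. *)
Lemma shortcut_forward_det j : 1 < j ->
  (forall a b, S a -> S b -> walk j a b -> E a b) -> forward_det.
Proof.
move=> j1 sc; have sck k a b : S a -> S b -> walk (k * j.-1).+1 a b -> E a b.
  elim: k a => [|k IH] a Sa Sb; first by rewrite mul0n walk1.
  have -> : (k.+1 * j.-1).+1 = j + k * j.-1 by lia.
  move=> /walk_split[c ac cb]; have Sc : S c by exact: (S_closed Sa Sb ac cb).
  by apply: IH => //; apply: walk_cons cb; apply: sc.
move=> e a a' b Se Sa Sa' Sb ea ea' ab; have [d a'e] := S_conn Sa' Se.
apply: (sck d.+2) => //; rewrite [d.+2 * _]mulnC.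
have -> : (j.-1 * d.+2).+1 = (j.-2 * d.+2) + (d.+1 + 2).
  by case: j j1 {sc sck} => [|[|j]] //= _; rewrite mulSn; lia.
apply: walk_cat (walk_iter _ _) _.
  by rewrite -[d.+2]addn1; apply: walk_cat a'e _; rewrite walk1.
by apply: walk_cat a'e _; apply: walk_cons ea _; rewrite walk1.
Qed.

(** A walk of length [l * l] is cut into [l] pieces of length [l]. Each gives an edge backwards, and
    these [l] edges form a walk to which the hypothesis applies once more. *)
Lemma reverse_shortcut l :
    (forall a b, S a -> S b -> walk l b a -> E a b) ->
  forall a b, S a -> S b -> walk (l * l) a b -> E a b.
Proof.
move=> sc; have aux k a b : S a -> S b -> walk (k * l) a b -> walk k b a.
  elim: k a => [|k IH] a Sa Sb; first by rewrite mul0n /= eq_sym.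
  rewrite mulSn => /walk_split[c ac cb]; have Sc : S c by exact: (S_closed Sa Sb ac cb).
  by apply: walk_rcons (sc _ _ Sc Sa ac); apply: IH.
by move=> a b Sa Sb /aux ba; apply: sc => //; apply: ba.
Qed.

(* If E is deterministic on S, the sets U k of the vertices reached from e0 in
   exactly k steps are the blocks of a cyclic partition, whose number is the
   length of the shortest closed walk at e0. *)
Lemma forward_det_state_split e0 : S e0 -> forward_det ->
  state_split_cycle_type (fun a b => E a b) S.
Proof.
move=> Se0 fd.
(* By induction the penultimate vertices [u] and [u'] have the same successors, so [v] and [v'] are
   both successors of [u']. *)
have same k v v' w : S v -> S v' -> S w ->
    walk k e0 v -> walk k e0 v' -> E v w -> E v' w.
  elim: k v v' w => [|k IH] v v' w Sv Sv' Sw; first by move=> /eqP-> /eqP->.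
  move=> /walk_unrcons[u e0u uv] /walk_unrcons[u' e0u' u'v'] vw.
  have Su : S u by exact: S_pred e0u uv.
  have Su' : S u' by exact: S_pred e0u' u'v'.
  have u'v : E u' v by apply: IH uv.
  by apply: (fd u' v).
pose U k v := S v /\ walk k e0 v.
have US k v w : U k v -> S w -> (E v w <-> U k.+1 w).
  move=> [Sv e0v] Sw; split=> [vw|[_ /walk_unrcons[u e0u uw]]].
    by split=> //; apply: walk_rcons vw.
  have Su : S u by exact: S_pred e0u uw.
  exact: (same k u).
have exp : exists p, walk p.+1 e0 e0 by apply: S_conn.
case: (ex_minnP exp) => p' e0e0 pmin; pose p := p'.+1.
have Up k w : U (p + k.+1) w <-> U k.+1 w.
  split=> -[Sw]; last by move=> h; split=> //; apply: walk_cat h.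
  move=> /walk_split[c e0c /walk_uncons[c1 cc1 c1w]]; split=> //.
  have Sc : S c by exact: (S_closed Se0 Sw e0c (walk_cons cc1 c1w)).
  have Sc1 : S c1 by apply: (S_succ Sc Sw cc1); exists k.
  by apply: walk_cons c1w; apply: (same p c).
have Upn c k w : U (c * p + k.+1) w <-> U k.+1 w.
  elim: c => [|c IH]; first by rewrite mul0n.
  by rewrite mulSn -addnA addnS Up -addnS.
(* Two levels that share a vertex [v] are followed by the same level, the successors of [v]. *)
have Umeet k l v s w : U k v -> U l v -> U (k + s.+1) w -> U (l + s.+1) w.
  move=> Ukv Ulv [Sw]; rewrite addnS -addSn => /walk_split[c e0c cw]; split=> //.
  have Sc : S c by exact: (S_closed Se0 Sw e0c cw).
  have [_ e0c'] : U l.+1 c.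
    by apply/(US l v) => //; apply/(US k v) => //; split.
  by rewrite addnS -addSn; apply: walk_cat cw.
(* The blocks start at [U 1]: [U 0] contains only [e0], while [U p] may be larger. *)
exists p, (fun i : 'I_p => U i.+1); split=> //.
- split.
  + move=> i; have : walk (i.+1 + (p - i.+1)) e0 e0 by rewrite subnKC.
    move=> /walk_split[c e0c ce0]; exists c; split=> //; exact: (S_closed Se0 Se0 e0c ce0).
  (* Otherwise [e0], which is at level [2 * p], would be at level [2 * p - (j - i)] too, hence on a
     closed walk of length [p - (j - i)], against the minimality of [p]. Level [p] itself would not
     do, as it need not come after level [j + 1]. *)
  + have disj (i j : 'I_p) v : i < j -> U i.+1 v -> U j.+1 v -> False.
      move=> ij Ui Uj.
      have Up0 : U p e0 by split.
      have /(Umeet _ _ _ _ _ Uj Ui) : U (j.+1 + (p + (p - j.+1)).-1.+1) e0.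
        have -> : j.+1 + (p + (p - j.+1)).-1.+1 = 1 * p + p'.+1.
          by move: (ltn_ord j); lia.
        by apply/Upn.
      have -> : i.+1 + (p + (p - j.+1)).-1.+1 = 1 * p + (p' - (j - i)).+1.
        by move: (ltn_ord j); lia.
      move=> /Upn[_ /pmin]; move: (ltn_ord j); lia.
    move=> i j _ _ [v [Ui Uj]].
    case: (ltngtP i j) => h; [|
      |exact: val_inj].
    * by case: (disj _ _ _ h Ui Uj).
    * by case: (disj _ _ _ h Uj Ui).
  + apply/predeqP => v; split=> [[i _ []]//|Sv].
    have [k e0v] := S_conn Se0 Sv.
    exists (Ordinal (ltn_pmod k (ltn0Sn p'))) => //=.
    by apply/(Upn (k %/ p)); rewrite addnS -divn_eq.
- move=> i v w Ui Sw; rewrite (US _ _ _ Ui Sw) /=.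
  case: (ltngtP i.+1 p) => h.
  + by rewrite modn_small.
  + by move: (ltn_ord i); lia.
  + by rewrite h modnn -addn1 Up.
Qed.

(** * Closed walks that avoid given edges *)

Section Gadgets.
Hypothesis not_fd : ~ forward_det.

(** By periodicity, the longer of the two arcs exists as soon as the shorter one does. If no pair
    [a], [b] worked, walks of length [d] would shortcut to edges, or walks of length [m - d] to
    reversed edges; both force forward determinism. *)
Lemma unshortcut m N q d : 0 < q ->
    (forall k c a b, N <= k -> walk (k + c * q) a b = walk k a b) ->
    q %| m -> 2 * N <= m -> 1 < d -> d + 1 < m ->
  exists a b, [/\ walk d a b, walk (m - d) b a & ~~ E a b].
Proof.
move=> q0 per qm Nm d1 dm.
have ret j k a b : S a -> S b -> walk j a b -> N <= k -> q %| j + k -> walk k b a.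
  move=> Sa Sb ab Nk qjk; have [d' ba] := S_conn Sb Sa.
  (* Going [c] times around a loop through [a] and [b], less the walk from [a] to [b], takes [K]
     steps with [K + j] divisible by [q]; periodicity then reduces [K] to [k]. *)
  pose c := q * k.+1.
  have : walk (c.-1 * (d'.+1 + j) + d'.+1) b a.
    by apply: (walk_cat _ ba); apply: walk_iter; apply: walk_cat ba ab.
  have c0 : 0 < c by rewrite muln_gt0 q0.
  have kc : k < c by rewrite /c; apply: leq_trans (leq_pmull _ _).
  set K := _ + _; have Kk : k <= K by rewrite /K; nia.
  have : q %| K - k.
    have : q %| (K + j) - (j + k).
      apply: dvdn_sub => //; have -> : K + j = c * (d'.+1 + j).
        by rewrite /K -{2}(prednK c0) mulSn; lia.
      by rewrite /c -mulnA dvdn_mulr.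
    by rewrite [j + k]addnC subnDr.
  by move=> /dvdnP[x hx]; rewrite -(subnKC Kk) hx per.
apply: contrapT => no.
have sc a b : walk d a b -> walk (m - d) b a -> E a b.
  by move=> ab ba; apply/negPn/negP => nab; apply: no; exists a, b.
have qm' : q %| d + (m - d) by rewrite subnKC //; lia.
case: (leqP d (m - d)) => hd.
  apply: not_fd; apply: (@shortcut_forward_det d) => // a b Sa Sb ab.
  by apply: sc => //; apply: ret ab _ _ => //; lia.
apply: not_fd; apply: (@shortcut_forward_det ((m - d) * (m - d))).
  by have : 1 < m - d by [lia]; nia.
apply: reverse_shortcut => a b Sa Sb ba; apply: sc => //.
by apply: ret ba _ _ => //; [lia|rewrite addnC].
Qed.

(* e -> a, e -> a', a' -> b but not a -> b: o runs through the loops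
   e a' b ... e and e a ... e, and f through the same loops in the opposite
   order. *)
Lemma gadget_start : exists L, 1 < L /\ forall m, L %| m -> 0 < m ->
  exists o f, [/\ closed_walk m o, closed_walk m f, ~~ E (f 1) (o 2),
    f 0 = o 0 & forall x, L <= x -> f x = o x].
Proof.
have [e [a' [a [b [[Se Sa' Sa Sb] ea' ea a'b ab]]]]] : exists e a' a b,
    [/\ [/\ S e, S a', S a & S b], E e a', E e a, E a' b & ~~ E a b].
  apply: contrapT => no; apply: not_fd => e a' a b Se Sa' Sa Sb ea' ea a'b.
  by apply/negPn/negP => ab; apply: no; exists e, a', a, b.
have [d1 /walkP[r1 w1]] := S_conn Sb Se; have [d2 /walkP[r2 w2]] := S_conn Sa Se.
have l1 : wfun (2 + d1.+1) e e (fcat 2 (nth e [:: e; a'; b]) r1).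
  by apply: wfun_cat w1; split=> // -[|[|]].
have l2 : wfun (1 + d2.+1) e e (fcat 1 (nth e [:: e; a]) r2).
  by apply: wfun_cat w2; split=> // -[|].
pose L1 := 2 + d1.+1; pose L2 := 1 + d2.+1; exists (L1 + L2); split=> // m Lm m0.
have [g wg] : exists g, wfun (m - (L1 + L2)) e e g.
  apply: walkP; have [k ->] := dvdnP Lm; rewrite -{2}[_ + _]mul1n -mulnBl.
  apply: walk_iter; have [_ h0 _] := wfun_cat l1 l2.
  have [h1 _ _] := wfun_cat l1 l2; rewrite -{2}h0 -{1}h1 -[X in walk X]subn0.
  by apply: wfun_walk (wfun_cat l1 l2) _; rewrite leqnn.
have Lm' : L1 + L2 <= m by apply: dvdn_leq.
have wo := wfun_cat (wfun_cat l1 l2) wg; have wf := wfun_cat (wfun_cat l2 l1) wg.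
move: wo wf; rewrite -/L1 -/L2 [L2 + L1]addnC subnKC // => wo wf.
have [r10 _ _] := w1; have [r20 _ _] := w2.
eexists; eexists; split; [exact: wfun_closed wo|exact: wfun_closed wf| | |].
- by rewrite /fcat /L1 /L2 !addSn /= r10 r20.
- by case: wo => -> _ _; case: wf => ->.
- by move=> x Lx; rewrite /fcat ltnNge Lx.
Qed.

(** The mirror image of [gadget_start], from the failure of backward determinism: the loops end in
    [b -> a -> e] and in [a' -> e], and the two walks differ only near the end of the period. *)
Lemma gadget_end : exists L, 1 < L /\ forall m, L %| m -> 0 < m ->
  exists o f, [/\ closed_walk m o, closed_walk m f, ~~ E (f (m - 2)) (o (m - 1)) &
    forall x, x <= m - L -> f x = o x].
Proof.
have [e [a [a' [b [[Se Sa Sa' Sb] ae a'e ba ba']]]]] : exists e a a' b,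
    [/\ [/\ S e, S a, S a' & S b], E a e, E a' e, E b a & ~~ E b a'].
  apply: contrapT => no; apply: not_fd; apply: backward_det_forward.
  move=> e a a' b Se Sa Sa' Sb ae a'e ba.
  by apply/negPn/negP => ba'; apply: no; exists e, a, a', b.
have [d1 /walkP[r1 w1]] := S_conn Se Sb; have [d2 /walkP[r2 w2]] := S_conn Se Sa'.
have l1 : wfun (d1.+1 + 2) e e (fcat d1.+1 r1 (nth e [:: b; a; e])).
  by apply: wfun_cat w1 _; split=> // -[|[|]].
have l2 : wfun (d2.+1 + 1) e e (fcat d2.+1 r2 (nth e [:: a'; e])).
  by apply: wfun_cat w2 _; split=> // -[|].
pose L1 := d1.+1 + 2; pose L2 := d2.+1 + 1; exists (L1 + L2); split=> [|m Lm m0].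
  by rewrite /L1 /L2; lia.
have [g wg] : exists g, wfun (m - (L1 + L2)) e e g.
  apply: walkP; have [k ->] := dvdnP Lm; rewrite -{2}[_ + _]mul1n -mulnBl.
  apply: walk_iter; have [_ h0 _] := wfun_cat l1 l2.
  have [h1 _ _] := wfun_cat l1 l2; rewrite -{2}h0 -{1}h1 -[X in walk X]subn0.
  by apply: wfun_walk (wfun_cat l1 l2) _; rewrite leqnn.
have Lm' : L1 + L2 <= m by apply: dvdn_leq.
have wo := wfun_cat wg (wfun_cat l1 l2); have wf := wfun_cat wg (wfun_cat l2 l1).
move: wo wf; rewrite -/L1 -/L2 [L2 + L1]addnC subnK // => wo wf.
eexists; eexists; split; [exact: wfun_closed wo|exact: wfun_closed wf| |].
- have hf : fcat (m - (L1 + L2)) g (fcat L2 (fcat d2.+1 r2 (nth e [:: a'; e]))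
      (fcat d1.+1 r1 (nth e [:: b; a; e]))) (m - 2) = b.
    rewrite /fcat; have -> : m - 2 < m - (L1 + L2) = false by rewrite /L1 /L2; lia.
    have -> : m - 2 - (m - (L1 + L2)) = L2 + d1.+1 by rewrite /L1 /L2; lia.
    have -> : L2 + d1.+1 < L2 = false by lia.
    by rewrite addKn ltnn subnn.
  have ho : fcat (m - (L1 + L2)) g (fcat L1 (fcat d1.+1 r1 (nth e [:: b; a; e]))
      (fcat d2.+1 r2 (nth e [:: a'; e]))) (m - 1) = a'.
    rewrite /fcat; have -> : m - 1 < m - (L1 + L2) = false by rewrite /L1 /L2; lia.
    have -> : m - 1 - (m - (L1 + L2)) = L1 + d2.+1 by rewrite /L1 /L2; lia.
    have -> : L1 + d2.+1 < L1 = false by lia.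
    by rewrite addKn ltnn subnn.
  by rewrite hf ho.
- move=> x xL; rewrite /fcat; case: ifP => // xL'.
  have -> : x - (m - (L1 + L2)) = 0 by lia.
  by have [-> _ _] := w1; have [-> _ _] := w2.
Qed.

End Gadgets.
End Component.
End Walks.

(** * Tables for a graph that fails condition D *)

Section Table.
Variables (A : finType) (E : rel A).
Let EP a b : Prop := E a b.

Lemma scc_conn S : scc EP S -> forall x y, S x -> S y -> exists k, walk E k.+1 x y.
Proof. by move=> [_ mr _] x y Sx Sy; apply/clos_trans_walk; apply: mr. Qed.

Lemma scc_closed S : scc EP S -> forall x y u k l,
  S x -> S y -> walk E k x u -> walk E l u y -> S u.
Proof.
move=> [S0 mr mx] x y u [|k] [|l] Sx Sy; [by move=> /eqP<-|by move=> /eqP<-| |].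
  by move=> _ /eqP->.
move=> xu uy; pose T v := clos_trans A EP x v /\ clos_trans A EP v x.
have <- : T = S.
  apply: mx => [v Sv|v w [xv vx] [xw wx]]; first by split; apply: mr.
  exact: t_trans vx xw.
split; first by apply/clos_trans_walk; exists k.
by apply: (t_trans _ _ _ y); [apply/clos_trans_walk; exists l|apply: mr].
Qed.

(** The three failing components may be distinct: only a common length [m] is needed. The places
    where [f] and [o] agree are those where a row of the table may switch between them. *)
Lemma not_D_walks : ~ condition_D EP -> exists2 m, 1 < m &
  (forall i j, i < m -> j < m -> j != i.+1 %% m ->
     exists2 o, closed_walk E m o & ~~ E (o i) (o j)) /\
  (forall i, i < m -> exists o f,
     [/\ closed_walk E m o, closed_walk E m f, ~~ E (f i) (o (i.+1 %% m)),
         i.+1 < m -> f 0 = o 0 \/ f m.-1 = o m.-1 &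
         i.+1 = m -> f m.-2 = o m.-2]).
Proof.
move=> nD.
have [v1 [l1 c1] n1] : exists2 v, exists k, walk E k.+1 v v & ~~ E v v.
  apply: contrapT => no; apply: nD; constructor 1 => S sS v Sv.
  apply: contrapT => nE; apply: no; exists v; last exact/negP.
  exact: (scc_conn sS Sv Sv).
have [v2 [w2 [l2 [e2 n2 c2]]]] : exists v w k, [/\ E v w, ~~ E w v & walk E k w v].
  apply: contrapT => no; apply: nD; constructor 2 => S sS v w Sv Sw _ vw.
  apply: contrapT => nE; apply: no; have [k wv] := scc_conn sS Sw Sv.
  by exists v, w, k.+1; split=> //; exact/negP.
have [S [e Se] [sS nS]] : exists2 S, S !=set0%classic &
    scc EP S /\ ~ state_split_cycle_type EP S.
  apply: contrapT => no; apply: nD; constructor 3 => S sS.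
  by apply: contrapT => nE; apply: no; exists S => //; case: (sS).
have conn := scc_conn sS; have clsd := scc_closed sS.
have nfd : ~ forward_det E S.
  by move=> fd; apply: nS; apply: (forward_det_state_split conn clsd Se fd).
have [N [q [q0 per]]] := walk_eventually_periodic E.
have [La [La1 gI]] := gadget_start conn nfd.
have [Lb [Lb1 gII]] := gadget_end conn clsd nfd.
(* [m] is a multiple of the gadget lengths, of the period [q], and of the lengths of the closed
   walks through [v1] and through the one-way edge [v2 -> w2]; the last factor makes it at least
   [2 * N]. *)
pose M := q * l1.+1 * l2.+1 * (2 * N).+1; pose m := La * Lb * M.
have M0 : 0 < M by rewrite !muln_gt0 q0.
have LL0 : 0 < La * Lb by rewrite muln_gt0; lia.
have m0 : 0 < m by rewrite muln_gt0 LL0.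
have dM x : x %| M -> x %| m by move=> xM; rewrite /m dvdn_mull.
have qm : q %| m by apply: dM; rewrite /M -!mulnA dvdn_mulr.
have l1m : l1.+1 %| m by apply: dM; rewrite /M [q * _]mulnC -!mulnA dvdn_mulr.
have l2m : l2.+1 %| m by apply: dM; rewrite /M [_ * l2.+1]mulnC -!mulnA dvdn_mulr.
have Lam : La %| m by rewrite /m -mulnA dvdn_mulr.
have Lbm : Lb %| m by rewrite /m [La * _]mulnC -mulnA dvdn_mulr.
have Nm : 2 * N <= m.
  apply: leq_trans (leq_pmull _ LL0); apply: leq_trans (leq_pmull _ _) => //.
  by rewrite !muln_gt0 q0.
have Lm : La + Lb <= m by apply: leq_trans (leq_pmulr _ M0); nia.
clearbody m; clear M M0 LL0 dM; exists m; first lia.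
have dist d : d < m -> d != 1 ->
    exists a b, [/\ walk E d a b, walk E (m - d) b a & ~~ E a b].
  move=> dm d1; have [d0|dn0] := eqVneq d 0.
    exists v1, v1; split=> //; first by rewrite d0 /=.
    by rewrite d0 subn0; have [k ->] := dvdnP l1m; apply: walk_iter.
  have [dl|dnl] := eqVneq d.+1 m; last first.
    by apply: (unshortcut conn clsd nfd q0 per) => //; lia.
  exists w2, v2; split=> //; last first.
    by have -> : m - d = 1 by [lia]; rewrite walk1.
  have [k mk] := dvdnP l2m.
  have -> : d = k.-1 * l2.+1 + l2.
    by case: k mk => [|k]; rewrite ?mulSn -dl => -[]; rewrite addnC.
  apply: (walk_cat _ c2); apply: walk_iter.
  exact: walk_rcons c2 e2.
split.
  move=> i j im jm ji; pose d := (j + (m - i)) %% m.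
  have dm : d < m by rewrite ltn_mod.
  have [a [b [ab ba nab]]] : exists a b,
      [/\ walk E d a b, walk E (m - d) b a & ~~ E a b].
    apply: dist => //; apply: contra ji => /eqP d1; have : (d + i) %% m = j.
      by rewrite /d modnDml -addnA subnK ?modnDr ?modn_small // ltnW.
    by rewrite d1 add1n => ->.
  have /walkP[f wf] := ab; have /walkP[g wg] := ba.
  have wo := wfun_cat wf wg; rewrite subnKC in wo; last exact: ltnW.
  exists (fun x => fcat d f g ((x + (m - i)) %% m)).
    exact: closed_walk_rot (wfun_closed wo).
  rewrite subnKC ?modnn -/d; last exact: ltnW.
  case: wo => -> _ _; rewrite /fcat ltnn subnn; by case: wg => ->.
have [o1 [f1 [co1 cf1 nI eI0 eI]]] := gI m Lam m0.
have [o2 [f2 [co2 cf2 nII eII]]] := gII m Lbm m0.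
clear dist qm l1m l2m Lam Lbm Nm.
(* Rotated to have its missing edge at [i], the first gadget differs only from [i] to [i + La - 2]
   modulo [m]. It serves when this range does not wrap around, and for [i = m - 1], where only
   position [m - 2] matters. Otherwise the second gadget leaves position 0 alone. *)
move=> i im; have [hi|hi] := boolP ((i <= m + 1 - La) || (i.+1 == m)).
  exists (fun x => o1 ((x + (m + 1 - i)) %% m)), (fun x => f1 ((x + (m + 1 - i)) %% m)).
  split; [exact: closed_walk_rot|exact: closed_walk_rot| | |].
  - rewrite modnDml addSn subnKC ?modnDr; last by lia.
    have -> : (m + 1) %% m = 1 by rewrite modnDl modn_small //; lia.
    by rewrite -addnS modnDl modn_small //; lia.
  - move=> im1; case: i im hi im1 => [|i] im hi im1; [right|left].
      have -> : m.-1 + (m + 1 - 0) = m + m by lia.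
      by rewrite modnDr modnn eI0.
    rewrite add0n; case: i im hi im1 => [|i] im hi im1.
      by rewrite addnK modnn eI0.
    by rewrite modn_small; [apply: eI|]; lia.
  - move=> im1; have -> : m.-2 + (m + 1 - i) = m by lia.
    by rewrite modnn eI0.
exists (fun x => o2 ((x + (m - 2 - i)) %% m)), (fun x => f2 ((x + (m - 2 - i)) %% m)).
split; [exact: closed_walk_rot|exact: closed_walk_rot| | |]; last by lia.
- rewrite modnDml addSn subnKC; last by lia.
  rewrite !modn_small; try lia.
  by have -> : (m - 2).+1 = m - 1 by lia.
- by move=> im1; left; rewrite add0n modn_small; [apply: eII|]; lia.
Qed.

End Table.

(** [rt] and [lt] stand for the parts of consecutive tiles that must coincide. The last clause puts
    all letters on closed walks, so that forbidden words can later be tested in place of Rauzy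
    edges. *)
Lemma not_D_table (A : finType) (E : rel A) (T : finType) (C : eqType)
    (rt lt : T -> C) : ~ condition_D (fun a b => E a b) ->
  exists m n (F : nat -> nat -> T -> A), [/\ 1 < m, 0 < n,
    forall i j psi, i < m -> j < m -> psi < n -> (j, psi) != (i.+1 %% m, 0) ->
      exists2 r, r < n & forall t t', ~~ E (F r i t) (F ((r + psi) %% n) j t'),
    forall i t t', i < m ->
      (forall r, r < n -> E (F r i t) (F r (i.+1 %% m) t')) <->
      (if i.+1 == m then rt t = lt t' else t = t') &
    forall r i t, i < m -> exists k, walk E k.+1 (F r i t) (F r i t)].
Proof.
move=> /not_D_walks[m m1 [pureP gadP]].
have m0 : 0 < m by lia.
have /choice[pure' pure_h'] : forall p : 'I_m * 'I_m, exists o,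
    closed_walk E m o /\ (p.2 != p.1.+1 %% m :> nat -> ~~ E (o p.1) (o p.2)).
  move=> [i j]; have [ji|ji] := boolP (j != i.+1 %% m :> nat).
    by have [o co no] := pureP i j (ltn_ord i) (ltn_ord j) ji; exists o.
  have [o [f [co _ _ _ _]]] := gadP i (ltn_ord i).
  by exists o; split=> //=; rewrite (negbTE ji).
pose pure i j := pure' (i, j); have pure_h i j := pure_h' (i, j).
have /choice[gad gad_h] : forall i : 'I_m, exists g : (nat -> A) * (nat -> A),
     [/\ closed_walk E m g.1, closed_walk E m g.2,
         ~~ E (g.2 i) (g.1 (i.+1 %% m)),
         i.+1 < m -> g.2 0 = g.1 0 \/ g.2 m.-1 = g.1 m.-1 &
         i.+1 = m -> g.2 m.-2 = g.1 m.-2].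
  by move=> i; have [o [f h]] := gadP i (ltn_ord i); exists (o, f).
(* Three kinds of rows: a walk without an edge from place [p] to place [q], one of the two walks of
   a gadget whatever the tile, and a gadget that tests the tile against [t1]. *)
pose K : finType := (('I_m * 'I_m) + ('I_m * bool) + ('I_m * T))%type.
have [n [w [n1 wn wP]]] := @all_pairs_at_all_shifts K
  (inl (inl (Ordinal m0, Ordinal m0))).
(* For [p < m - 1] the bit is constant over the types and changes at most between [m - 1] and 0. For
   [p = m - 1] it must survive that boundary, where [rt] meets [lt], and changes at most between
   [m - 2] and [m - 1]. *)
pose bit (p : 'I_m) (t1 : T) (i : nat) t :=
  if p.+1 < m then t == t1 else if i.+1 == m then rt t == rt t1 else lt t == rt t1.
pose row (k : K) (i : nat) (t : T) : A := match k with
  | inl (inl (p, q)) => pure p q i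
  | inl (inr (p, b)) => if b then (gad p).2 i else (gad p).1 i
  | inr (p, t1) => if bit p t1 i t then (gad p).2 i else (gad p).1 i end.
have wS k : exists2 r, r < n & w r = k.
  by have [r [rn wr _]] := wP 1 n1 k k; exists r.
exists m, n, (fun r => row (w r)); split=> //; first lia.
- move=> i j psi im jm psin; rewrite xpair_eqE negb_and => h.
  pose i' := Ordinal im; pose j' := Ordinal jm.
  have [ji|ji] := eqVneq j (i.+1 %% m).
    have psi0 : 0 < psi < n by move: h; rewrite psin lt0n ji eqxx andbT.
    have [r [rn wr wr']] := wP psi psi0 (inl (inr (i', true))) (inl (inr (i', false))).
    exists r => // t t'; rewrite wn wr wr' /=.
    by have [_ _ + _ _] := gad_h i'; rewrite /= -ji.
  have [psi0|psi0] := posnP psi.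
    have [r rn wr] := wS (inl (inl (i', j'))).
    exists r => // t t'; rewrite wn psi0 addn0 wr /=.
    by have [_ /(_ ji)] := pure_h i' j'.
  have psi0' : 0 < psi < n by rewrite psin psi0.
  have [r [rn wr wr']] := wP psi psi0' (inl (inl (i', j'))) (inl (inl (i', j'))).
  exists r => // t t'; rewrite wn wr wr' /=.
  by have [_ /(_ ji)] := pure_h i' j'.
- move=> i t t' im; split.
    move=> h; pose i' := Ordinal im; have [r rn wr] := wS (inr (i', t)).
    have := h r rn; rewrite wr /= /bit /=; have [_ _ ng _ _] := gad_h i'.
    case: (ltngtP i.+1 m) => im1; last 1 first.
    + rewrite im1 modnn eqxx; move: ng; rewrite /= im1 modnn => ng.
      have -> : 1 == m = false by lia.
      by case: eqP => // _; rewrite (negbTE ng).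
    + by rewrite eqxx; case: eqP => // _; rewrite (negbTE ng).
    + lia.
  move=> h r rn; case: (w r) => [[[p q]|[p b]]|[p t1]] /=.
  + by have [c _] := pure_h p q; apply: c.
  + by have [c1 c2 _ _ _] := gad_h p; case: b; [apply: c2|apply: c1].
  + have [c1 c2 _ c4 c5] := gad_h p.
    have cb b : E (if b then (gad p).2 i else (gad p).1 i)
        (if b then (gad p).2 (i.+1 %% m) else (gad p).1 (i.+1 %% m)).
      by case: b; [apply: c2|apply: c1].
    have [bb|bb] := eqVneq (bit p t1 i t) (bit p t1 (i.+1 %% m) t').
      by rewrite bb; apply: cb.
    have [im1|im1] := eqVneq i.+1 m.
      have [pm|pm] := ltnP p.+1 m; last first.
        move: h bb; rewrite im1 eqxx modnn /bit ltnNge pm /= im1 eqxx => ->.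
        by have -> : 1 == m = false by [lia]; rewrite eqxx.
      have im' : i = m.-1 by lia.
      move: (cb true) (cb false) => /=; rewrite im1 modnn im' => e1 e2.
      by case: (c4 pm) => h4; rewrite h4 in e1; do 2 case: ifP => _; rewrite ?h4.
    move: h; rewrite (negbTE im1) => tt'; subst t'.
    have im1' : i.+1 < m by lia.
    rewrite modn_small // in bb cb *.
    have [pm|pm] := ltnP p.+1 m; first by move: bb; rewrite /bit pm eqxx.
    move: bb; rewrite /bit ltnNge pm /= (negbTE im1).
    have [im2|im2] := eqVneq i.+2 m; last by rewrite eqxx.
    have pm' : p.+1 = m by move: (ltn_ord p); lia.
    have im' : i = m.-2 by lia.
    move: (cb true) (cb false) => /= e1 e2 _.
    have h5 := c5 pm'.
    by do 2 case: ifP => _; move: e1 e2; rewrite !im' !h5.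
- move=> r i t im; case: (w r) => [[[p q]|[p b]]|[p t1]] /=.
  + by have [c _] := pure_h p q; apply: closed_walk_cyclic c.
  + have [c1 c2 _ _ _] := gad_h p.
    by case: b; [apply: closed_walk_cyclic c2|apply: closed_walk_cyclic c1].
  + have [c1 c2 _ _ _] := gad_h p.
    by case: ifP => _; [apply: closed_walk_cyclic c2|apply: closed_walk_cyclic c1].
Qed.

(** * Computable functions *)

(** The inverse of [npair], obtained by stepping along the antidiagonals. *)
Fixpoint unpair (z : nat) : nat * nat :=
  if z is z'.+1 then
    let p := unpair z' in if p.1 is x.+1 then (x, p.2.+1) else (p.2.+1, 0)
  else (0, 0).

Definition nfst z := (unpair z).1.
Definition nsnd z := (unpair z).2.

Lemma npairS x y : npair x y.+1 = (npair x.+1 y).+1.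
Proof. by rewrite /npair addSnnS addnS. Qed.

Lemma npair0 x : npair x.+1 0 = (npair 0 x).+1.
Proof. by rewrite /npair !addn0 add0n binS bin1; lia. Qed.

Lemma npairK z : npair (nfst z) (nsnd z) = z.
Proof.
rewrite /nfst /nsnd; elim: z => [|z] //=; case: (unpair z) => -[|x] y /= <-.
  exact: npair0.
exact: npairS.
Qed.

Lemma unpairK x y : unpair (npair x y) = (x, y).
Proof.
have [z zxy] : exists z, npair x y = z by exists (npair x y).
rewrite zxy; elim: z x y zxy => [|z IH] x [|y].
- by case: x => [|x] //; rewrite npair0.
- by rewrite npairS.
- by case: x => [|x] //; rewrite npair0 => -[/IH /= ->].
- by rewrite npairS => -[/IH /= ->].
Qed.

Lemma nfstE x y : nfst (npair x y) = x. Proof. by rewrite /nfst unpairK. Qed.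
Lemma nsndE x y : nsnd (npair x y) = y. Proof. by rewrite /nsnd unpairK. Qed.

Lemma npair_inj x y x' y' : npair x y = npair x' y' -> x = x' /\ y = y'.
Proof. by move=> /(congr1 unpair); rewrite !unpairK => -[-> ->]. Qed.

Lemma leq_npairr x y : y <= npair x y. Proof. exact: leq_addl. Qed.

Lemma leq_npairl x y : x <= npair x y.
Proof. by rewrite /npair binS bin1; lia. Qed.

Definition computable (f : nat -> nat) := exists c, forall x, computes c x (f x).

Lemma comp_zero : computable (fun=> 0). Proof. by exists RZero. Qed.

Lemma comp_comp f g : computable f -> computable g -> computable (fun x => f (g x)).
Proof.
by move=> [c cf] [d dg]; exists (RComp c d) => x; exists (g x).
Qed.

Lemma comp_succ f : computable f -> computable (fun x => (f x).+1).
Proof. by apply: (@comp_comp succn); exists RSucc. Qed.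

Lemma comp_const k : computable (fun=> k).
Proof. elim: k => [|k]; [exact: comp_zero|exact: comp_succ]. Qed.

Lemma comp_fst f : computable f -> computable (fun x => nfst (f x)).
Proof.
by apply: comp_comp; exists RLeft => x; exists (nsnd x); rewrite npairK.
Qed.

Lemma comp_snd f : computable f -> computable (fun x => nsnd (f x)).
Proof.
by apply: comp_comp; exists RRight => x; exists (nfst x); rewrite npairK.
Qed.

Lemma comp_npair f g : computable f -> computable g -> computable (fun x => npair (f x) (g x)).
Proof.
by move=> [c cf] [d dg]; exists (RPair c d) => x; exists (f x), (g x).
Qed.

(** The identity is not a basic function; it is the pairing of the two projections. *)
Lemma comp_id : computable (fun x => x).
Proof.
have [c h] : computable (fun x => npair (nfst x) (nsnd x)).
  by apply: comp_npair; exists RLeft + exists RRight => x;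
    [exists (nsnd x)|exists (nfst x)]; rewrite npairK.
by exists c => x; have := h x; rewrite npairK.
Qed.

Lemma comp_ext f g : f =1 g -> computable f -> computable g.
Proof. by move=> fg [c h]; exists c => x; rewrite -fg. Qed.

(** Primitive recursion with the input as parameter; the step function receives the input, the
    counter and the accumulator as one nested pair. *)
Lemma comp_iteri k g f : computable k ->
  computable (fun z => g (nfst z) (nfst (nsnd z)) (nsnd (nsnd z))) -> computable f ->
  computable (fun x => iteri (k x) (g x) (f x)).
Proof.
move=> ck [d dg] [c cf].
have ch : computable (fun z => iteri (nsnd z) (g (nfst z)) (f (nfst z))).
  exists (RPrec c d) => z; exists (nfst z), (nsnd z).
  exists (fun i => iteri i (g (nfst z)) (f (nfst z))).
  split=> //; first by rewrite npairK.
  move=> i _ /=; set r := iteri _ _ _; have := dg (npair (nfst z) (npair i r)).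
  by rewrite !nfstE !nsndE nfstE.
have := comp_comp ch (comp_npair comp_id ck).
by apply: comp_ext => x; rewrite nfstE nsndE.
Qed.

(** Minimisation looks for a zero, whence the negation. Nothing is claimed on inputs without a
    solution. *)
Lemma comp_mu (p : nat -> nat -> bool) :
  computable (fun z => ~~ p (nfst z) (nsnd z) : nat) ->
  exists c, forall x y, p x y -> (forall i, i < y -> ~~ p x i) -> computes c x y.
Proof.
move=> [c h]; exists (RMu c) => x y pxy pi; split.
  by have := h (npair x y); rewrite nfstE nsndE pxy.
by move=> i /pi pn; exists 0; have := h (npair x i); rewrite nfstE nsndE pn.
Qed.

Lemma comp_addn f g : computable f -> computable g -> computable (fun x => f x + g x).
Proof.
move=> cf cg; apply: comp_ext (comp_iteri (g := fun _ _ a => a.+1) cg _ cf).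
  by move=> x; elim: (g x) => [|k /= ->]; rewrite ?addn0 ?addnS.
by apply: comp_succ; do 2 apply: comp_snd; exact: comp_id.
Qed.

Lemma comp_pred f : computable f -> computable (fun x => (f x).-1).
Proof.
move=> cf; apply: comp_ext (comp_iteri (g := fun _ i _ => i) cf _ comp_zero).
  by move=> x; case: (f x).
by apply: comp_fst; apply: comp_snd; exact: comp_id.
Qed.

Lemma comp_subn f g : computable f -> computable g -> computable (fun x => f x - g x).
Proof.
move=> cf cg; apply: comp_ext (comp_iteri (g := fun _ _ a => a.-1) cg _ cf).
  by move=> x; elim: (g x) => [|k /= ->]; rewrite ?subn0 ?subnS.
by apply: comp_pred; do 2 apply: comp_snd; exact: comp_id.
Qed.

Lemma comp_muln f g : computable f -> computable g -> computable (fun x => f x * g x).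
Proof.
move=> cf cg.
apply: comp_ext (comp_iteri (g := fun x _ a => a + f x) cg _ comp_zero).
  by move=> x; elim: (g x) => [|k /= ->]; rewrite ?muln0 // mulnS addnC.
apply: comp_addn; first by do 2 apply: comp_snd; exact: comp_id.
by apply: comp_comp cf _; apply: comp_fst comp_id.
Qed.

Lemma comp_expn f g : computable f -> computable g -> computable (fun x => f x ^ g x).
Proof.
move=> cf cg.
apply: comp_ext (comp_iteri (g := fun x _ a => f x * a) cg _ (comp_const 1)).
  by move=> x; elim: (g x) => [|k /= ->]; rewrite ?expn0 // expnS.
apply: comp_muln; last by do 2 apply: comp_snd; exact: comp_id.
by apply: comp_comp cf _; apply: comp_fst comp_id.
Qed.

Lemma comp_if (b : nat -> bool) f g :
  computable (fun x => b x) -> computable f -> computable g ->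
  computable (fun x => if b x then f x else g x).
Proof.
move=> cb cf cg; apply: comp_ext (comp_iteri (g := fun x _ _ => f x) cb _ cg).
  by move=> x; case: (b x).
by apply: comp_comp cf _; apply: comp_fst comp_id.
Qed.

Lemma comp_negb (b : nat -> bool) : computable (fun x => b x) -> computable (fun x => ~~ b x).
Proof.
move=> cb; apply: comp_ext (comp_if cb (comp_const 0) (comp_const 1)).
by move=> x; case: (b x).
Qed.

Lemma comp_andb (b c : nat -> bool) :
  computable (fun x => b x) -> computable (fun x => c x) -> computable (fun x => b x && c x).
Proof.
move=> cb cc; apply: comp_ext (comp_if cb cc (comp_const 0)).
by move=> x; case: (b x).
Qed.

Lemma comp_orb (b c : nat -> bool) :
  computable (fun x => b x) -> computable (fun x => c x) -> computable (fun x => b x || c x).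
Proof.
move=> cb cc; apply: comp_ext (comp_if cb (comp_const 1) cc).
by move=> x; case: (b x).
Qed.

Lemma comp_leq f g : computable f -> computable g -> computable (fun x => f x <= g x).
Proof.
move=> cf cg; have := comp_iteri (comp_subn cf cg)
  (g := fun _ _ _ => 0) (comp_const 0) (comp_const 1).
by apply: comp_ext => x; rewrite /leq; case: (f x - g x).
Qed.

Lemma comp_eqn f g : computable f -> computable g -> computable (fun x => f x == g x).
Proof.
move=> cf cg; apply: comp_ext (comp_andb (comp_leq cf cg) (comp_leq cg cf)).
by move=> x; rewrite -eqn_leq.
Qed.

Lemma comp_eqb (b c : nat -> bool) :
  computable (fun x => b x) -> computable (fun x => c x) -> computable (fun x => b x == c x).
Proof.
move=> cb cc; apply: comp_ext (comp_eqn cb cc).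
by move=> x; case: (b x); case: (c x).
Qed.

Fixpoint bforall (k : nat) (p : nat -> bool) : bool :=
  if k is j.+1 then p j && bforall j p else true.

Definition bexists k (p : nat -> bool) := ~~ bforall k (fun i => ~~ p i).

Lemma bforallP k (p : nat -> bool) : reflect (forall i, i < k -> p i) (bforall k p).
Proof.
apply: (iffP idP); elim: k => [|k IH] //=.
  move=> /andP[pk /IH h] i; rewrite ltnS leq_eqVlt => /orP[/eqP->//|]; exact: h.
by move=> h; rewrite h // IH // => i ik; apply: h; apply: ltnW.
Qed.

Lemma bexistsP k (p : nat -> bool) :
  reflect (exists2 i, i < k & p i) (bexists k p).
Proof.
apply: (iffP idP) => [|[i ik pi]]; last first.
  by apply/negP => /bforallP/(_ i ik); rewrite pi.
elim: k => [|k IH] //; rewrite /bexists /= negb_and negbK => /orP[pk|/IH[i ik pi]].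
  by exists k.
by exists i => //; apply: ltnW.
Qed.

Lemma comp_bforall k (p : nat -> nat -> bool) : computable k -> computable (fun z => p (nfst z) (nsnd z) : nat) ->
  computable (fun x => bforall (k x) (p x)).
Proof.
move=> ck cp; apply: comp_ext (comp_iteri
  (g := fun x i a => if p x i then a else 0) ck _ (comp_const 1)).
  by move=> x; elim: (k x) => [|j /= ->] //; case: (p x j).
apply: comp_if (comp_const 0); last by do 2 apply: comp_snd; exact: comp_id.
have := comp_comp cp (comp_npair (comp_fst comp_id) (comp_fst (comp_snd comp_id))).
by apply: comp_ext => x; rewrite nfstE nsndE.
Qed.

Lemma comp_bexists k (p : nat -> nat -> bool) : computable k -> computable (fun z => p (nfst z) (nsnd z) : nat) ->
  computable (fun x => bexists (k x) (p x)).
Proof.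
by move=> ck cp; apply: comp_negb; apply: comp_bforall ck _; apply: comp_negb.
Qed.

Lemma comp_divn f g : computable f -> computable g -> computable (fun x => f x %/ g x).
Proof.
move=> cf cg; have c1 : computable (fun z => nfst (nsnd z)).
  by apply: comp_fst; apply: comp_snd comp_id.
have cfz : computable (fun z => f (nfst z)) by apply: comp_comp cf _; apply: comp_fst comp_id.
have cgz : computable (fun z => g (nfst z)) by apply: comp_comp cg _; apply: comp_fst comp_id.
have := comp_iteri
  (g := fun x i a => if i.+1 * g x <= f x then i.+1 else a) cf _ comp_zero.
move=> /(_ _)/(comp_if (comp_leq (comp_const 1) cg)) h.
apply: comp_ext (h _ _ comp_zero) => [x|]; last first.
  apply: comp_if; [|exact: comp_succ|by do 2 apply: comp_snd; exact: comp_id].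
  by apply: comp_leq => //; apply: comp_muln => //; apply: comp_succ.
case: posnP => [->|g0]; first by rewrite divn0.
have H k : iteri k (fun i a => if i.+1 * g x <= f x then i.+1 else a) 0 =
    minn k (f x %/ g x).
  by elim: k => [|k /= ->]; rewrite ?min0n // -leq_divRL //; case: leqP; lia.
by rewrite H; apply/minn_idPr; exact: leq_div.
Qed.

Lemma comp_modn f g : computable f -> computable g -> computable (fun x => f x %% g x).
Proof.
move=> cf cg; apply: comp_ext (comp_subn cf (comp_muln (comp_divn cf cg) cg)).
by move=> x; rewrite {1}(divn_eq (f x) (g x)) addKn.
Qed.

Definition nif (b : bool) (x y : nat) := if b then x else y.

(** Descends along the syntax of the function; an unknown head symbol is left as a goal, for which
    [comp_with] tries further closure lemmas. *)
Ltac comp_tac := cbv beta;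
  lazymatch goal with
  | |- computable (fun x => x) => exact comp_id
  | |- computable nfst => exact (comp_fst comp_id)
  | |- computable nsnd => exact (comp_snd comp_id)
  | |- computable (fun _ => ?k) => exact (comp_const k)
  | |- computable (fun x => nat_of_bool (@?b x && @?c x)) => apply (@comp_andb b c); comp_tac
  | |- computable (fun x => nat_of_bool (@?b x || @?c x)) => apply (@comp_orb b c); comp_tac
  | |- computable (fun x => nat_of_bool (~~ @?b x)) => apply (@comp_negb b); comp_tac
  | |- computable (fun x => nat_of_bool (@eq_op Datatypes_nat__canonical__eqtype_Equality (@?b x) (@?c x))) => apply (@comp_eqn b c); comp_tac
  | |- computable (fun x => nat_of_bool (@eq_op Datatypes_bool__canonical__eqtype_Equality (@?b x) (@?c x))) => apply (@comp_eqb b c); comp_tac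
  | |- computable (fun x => nat_of_bool (@?b x <= @?c x)) => apply (@comp_leq b c); comp_tac
  | |- computable (fun x => nat_of_bool (bforall (@?k x) (@?p x))) => apply (@comp_bforall k p); comp_tac
  | |- computable (fun x => nat_of_bool (bexists (@?k x) (@?p x))) => apply (@comp_bexists k p); comp_tac
  | |- computable (fun x => iteri (@?k x) (@?g x) (@?f x)) => apply (@comp_iteri k g f); comp_tac
  | |- computable (fun x => nif (@?b x) (@?f x) (@?g x)) => apply (@comp_if b f g); comp_tac
  | |- computable (fun x => S (@?f x)) => apply (@comp_succ f); comp_tac
  | |- computable (fun x => (@?f x).-1) => apply (@comp_pred f); comp_tac
  | |- computable (fun x => @?f x + @?g x) => apply (@comp_addn f g); comp_tac
  | |- computable (fun x => @?f x - @?g x) => apply (@comp_subn f g); comp_tac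
  | |- computable (fun x => @?f x * @?g x) => apply (@comp_muln f g); comp_tac
  | |- computable (fun x => @?f x ^ @?g x) => apply (@comp_expn f g); comp_tac
  | |- computable (fun x => @?f x %/ @?g x) => apply (@comp_divn f g); comp_tac
  | |- computable (fun x => @?f x %% @?g x) => apply (@comp_modn f g); comp_tac
  | |- computable (fun x => npair (@?f x) (@?g x)) => apply (@comp_npair f g); comp_tac
  | |- computable (fun x => nfst (@?f x)) => apply (@comp_fst f); comp_tac
  | |- computable (fun x => nsnd (@?f x)) => apply (@comp_snd f); comp_tac
  | H : computable ?f |- computable ?f => exact H
  | H : computable ?f |- computable (fun x => ?f (@?g x)) => apply (@comp_comp f g H); comp_tac
  | _ => idtac
  end.

(** * The search for a table and the list of forbidden words *)

(** Tiles, stacks, words and whole tables are stored as numbers in a suitable base, so that all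
    searches and enumerations run over numbers. *)
Definition digit (a D i : nat) := (D %/ a ^ i) %% a.

Fixpoint undigits (a K : nat) (f : nat -> nat) : nat :=
  if K is K'.+1 then f 0 + a * undigits a K' (fun i => f i.+1) else 0.

Lemma digit0 a D : digit a D 0 = D %% a.
Proof. by rewrite /digit expn0 divn1. Qed.

Lemma digitS a D i : digit a D i.+1 = digit a (D %/ a) i.
Proof. by rewrite /digit expnS divnMA. Qed.

Lemma digit_lt a D i : 0 < a -> digit a D i < a.
Proof. by rewrite /digit ltn_mod. Qed.

Lemma undigits_lt a K f : (forall i, i < K -> f i < a) -> undigits a K f < a ^ K.
Proof.
elim: K f => [|K IH] f fa //=; have f0 := fa 0 isT.
have := IH (fun i => f i.+1) (fun i iK => fa i.+1 iK); rewrite expnS.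
by set u := undigits _ _ _; set v := a ^ K; nia.
Qed.

Lemma undigitsK a K f k : (forall i, i < K -> f i < a) -> k < K ->
  digit a (undigits a K f) k = f k.
Proof.
elim: K f k => [|K IH] f k fa //= kK; have f0 := fa 0 isT.
have a0 : 0 < a by lia.
case: k kK => [|k] kK; first by rewrite digit0 addnC mulnC modnMDl modn_small.
rewrite digitS addnC mulnC divnMDl // divn_small // addn0.
by rewrite IH // => i; apply: (fa i.+1).
Qed.

Lemma digit_ext a K D D' : D < a ^ K -> D' < a ^ K ->
  (forall k, k < K -> digit a D k = digit a D' k) -> D = D'.
Proof.
elim: K D D' => [|K IH] D D'; first by rewrite expn0 !ltnS !leqn0 => /eqP-> /eqP->.
rewrite expnS => h1 h2 hd; have a0 : 0 < a by lia.
rewrite (divn_eq D a) (divn_eq D' a) -!digit0 hd // (IH (D %/ a) (D' %/ a)) //.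
- by rewrite ltn_divLR // mulnC.
- by rewrite ltn_divLR // mulnC.
- by move=> k kK; rewrite -!digitS hd.
Qed.

(** The empty list has code 0 and [nsnd 0 = 0], so that dropping past the end stays at 0. *)
Definition cdrop (c i : nat) : nat := iteri i (fun _ d => nsnd d.-1) c.
Definition cnth (c i : nat) : nat := nfst (cdrop c i).-1.

Section CodeSeq.
Variables (T : Type) (f : T -> nat).

Lemma cdropE s i : cdrop (code_seq f s) i = code_seq f (drop i s).
Proof.
rewrite /cdrop; elim: i => [|i /= ->]; first by rewrite drop0.
rewrite -add1n -drop_drop drop1; case: (drop i s) => [|x s'] //=.
by rewrite nsndE.
Qed.

Lemma cdrop_eq0 s i : (cdrop (code_seq f s) i == 0) = (size s <= i).
Proof.
rewrite cdropE leqNgt -[i < _]subn_gt0 -size_drop.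
by case: (drop i s).
Qed.

Lemma cnthE x0 s i : i < size s -> cnth (code_seq f s) i = f (nth x0 s i).
Proof. by move=> si; rewrite /cnth cdropE (drop_nth x0) //= nfstE. Qed.

Lemma cnth_default s i : size s <= i -> cnth (code_seq f s) i = 0.
Proof. by move=> si; rewrite /cnth cdropE drop_oversize. Qed.

Lemma size_leq_code s : size s <= code_seq f s.
Proof.
elim: s => //= x s IH; rewrite ltnS; apply: leq_trans IH _; exact: leq_npairr.
Qed.

End CodeSeq.

Lemma code_seq_inj (T : Type) (f : T -> nat) : injective f -> injective (code_seq f).
Proof.
by move=> fi; elim=> [|x s IH] [|y t] //= [] /npair_inj[/fi-> /IH->].
Qed.

Lemma mem_leq_code (T : eqType) (f : T -> nat) x s : x \in s -> f x <= code_seq f s.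
Proof.
elim: s => //= y s IH; rewrite inE => /orP[/eqP->|/IH h].
  by apply: leqW; exact: leq_npairl.
by apply: leqW; apply: leq_trans h _; exact: leq_npairr.
Qed.

(** The code [c] of the forbidden words also bounds their number; entries past the end read as 0,
    which codes no two-letter word. *)
Definition edgeN (c u v : nat) : bool :=
  bforall c (fun i => ~~ (cnth c i == (npair u (npair v 0).+1).+1)).

Definition tableN (a m tau D r i t : nat) := digit a D ((r * m + i) * tau + t).

Definition syncN (c a tau m n D : nat) : bool :=
  bforall m (fun i => bforall m (fun j => bforall n (fun psi =>
    ((j == i.+1 %% m) && (psi == 0)) ||
    bexists n (fun r => bforall tau (fun t => bforall tau (fun t' =>
      ~~ edgeN c (tableN a m tau D r i t)
                 (tableN a m tau D ((r + psi) %% n) j t'))))))).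

Definition shiftedN (b R t t' : nat) : bool :=
  bforall (2 * R) (fun x => digit b t x.+1 == digit b t' x).

Definition transmN (c a b R tau m n D : nat) : bool :=
  bforall m (fun i => bforall tau (fun t => bforall tau (fun t' =>
    bforall n (fun r => edgeN c (tableN a m tau D r i t)
                                (tableN a m tau D r (i.+1 %% m) t')) ==
    (((i.+1 == m) && shiftedN b R t t') || (~~ (i.+1 == m) && (t == t')))))).

Definition tableP (c a b R tau m n D : nat) : bool :=
  [&& 1 < m, 0 < n, syncN c a tau m n D & transmN c a b R tau m n D].

(* [posN R (code_int z)] is R + z, when `|z| <= R. *)
Definition posN (R c : nat) : nat := nif (c %% 2 == 1) (R - (c %/ 2).+1) (R + c %/ 2).

Definition cellN (b R tau S e : nat) : bool :=
  digit b (digit tau S (posN R (nsnd (nfst e))).+1) (posN R (nfst (nfst e))) == nsnd e.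

Definition stackN (cF b R tau S : nat) : bool :=
  bforall cF (fun i => (cdrop cF i == 0) ||
    ~~ bforall (cnth cF i) (fun k => (cdrop (cnth cF i) k == 0) ||
         cellN b R tau S (cnth (cnth cF i) k))).

(** A window of [2 * R + 3] blocks at a nonzero phase touches one block more, hence [2 * R + 4]
    tiles. *)
Definition goodN (cF a b R tau m n D u : nat) : bool :=
  bexists m (fun j => bexists n (fun phi => bexists (tau ^ (2 * R + 4)) (fun S =>
    stackN cF b R tau S &&
    bforall ((2 * R + 3) * n) (fun y =>
      digit a u y ==
      tableN a m tau D ((y + phi) %% n) j (digit tau S ((y + phi) %/ n)))))).

Definition wordN (a l u : nat) : nat :=
  iteri l (fun i acc => (npair (digit a u (l - i.+1)) acc).+1) 0.

Definition badwordsN (cF a b R tau m n D : nat) : nat :=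
  iteri (a ^ ((2 * R + 3) * n)) (fun u acc =>
    nif (goodN cF a b R tau m n D u) acc
      (npair (wordN a ((2 * R + 3) * n) u) acc).+1) 0.

Ltac comp_with tac := comp_tac; try (tac tt; comp_with tac).

Lemma comp_digit a D i : computable a -> computable D -> computable i ->
  computable (fun x => digit (a x) (D x) (i x)).
Proof. by move=> *; rewrite /digit; comp_tac. Qed.

Lemma comp_cdrop c i : computable c -> computable i -> computable (fun x => cdrop (c x) (i x)).
Proof. by move=> *; rewrite /cdrop; comp_tac. Qed.

Lemma comp_cnth c i : computable c -> computable i -> computable (fun x => cnth (c x) (i x)).
Proof. by move=> *; rewrite /cnth; comp_with ltac:(fun _ => apply comp_cdrop). Qed.

Lemma comp_edgeN c u v : computable c -> computable u -> computable v ->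
  computable (fun x => edgeN (c x) (u x) (v x)).
Proof.
by move=> *; rewrite /edgeN; comp_with ltac:(fun _ => apply comp_cnth).
Qed.

Lemma comp_tableN a m tau D r i t : computable a -> computable m -> computable tau -> computable D ->
  computable r -> computable i -> computable t ->
  computable (fun x => tableN (a x) (m x) (tau x) (D x) (r x) (i x) (t x)).
Proof.
by move=> *; rewrite /tableN; comp_with ltac:(fun _ => apply comp_digit).
Qed.

Lemma comp_tableP c a b R tau m n D : computable c -> computable a -> computable b -> computable R ->
  computable tau -> computable m -> computable n -> computable D ->
  computable (fun x => tableP (c x) (a x) (b x) (R x) (tau x) (m x) (n x) (D x)).
Proof.
move=> *; rewrite /tableP /syncN /transmN /shiftedN.
by comp_with ltac:(fun _ => first
  [apply comp_digit | apply comp_edgeN | apply comp_tableN]).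
Qed.

Lemma comp_posN R c : computable R -> computable c -> computable (fun x => posN (R x) (c x)).
Proof. by move=> *; rewrite /posN; comp_tac. Qed.

Lemma comp_stackN cF b R tau S : computable cF -> computable b -> computable R -> computable tau -> computable S ->
  computable (fun x => stackN (cF x) (b x) (R x) (tau x) (S x)).
Proof.
move=> *; rewrite /stackN /cellN.
by comp_with ltac:(fun _ => first
  [apply comp_digit | apply comp_posN | apply comp_cnth | apply comp_cdrop]).
Qed.

Lemma comp_badwordsN cF a b R tau m n D : computable cF -> computable a -> computable b -> computable R ->
  computable tau -> computable m -> computable n -> computable D ->
  computable (fun x => badwordsN (cF x) (a x) (b x) (R x) (tau x) (m x) (n x) (D x)).
Proof.
move=> *; rewrite /badwordsN /goodN /wordN.
by comp_with ltac:(fun _ => first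
  [apply comp_digit | apply comp_stackN | apply comp_tableN]).
Qed.

Definition inA x := nfst (nfst x).
Definition inFH x := nsnd (nfst x).
Definition inB x := nfst (nsnd x).
Definition inFY x := nsnd (nsnd x).
Definition tilesN x := inB x ^ (2 * inFY x).+1.

(* The positions in the patterns are bounded by the code of the list of
   patterns, which thus serves as the radius R. *)
Definition searchN x z : bool :=
  tableP (inFH x) (inA x) (inB x) (inFY x) (tilesN x)
    (nfst z) (nfst (nsnd z)) (nsnd (nsnd z)).

Definition outputN x z : nat :=
  npair (nfst z) (npair (nfst (nsnd z))
    (badwordsN (inFY x) (inA x) (inB x) (inFY x) (tilesN x)
       (nfst z) (nfst (nsnd z)) (nsnd (nsnd z)))).

Lemma root_program : exists c, forall x z, searchN x z ->
  (forall i, i < z -> ~~ searchN x i) -> computes c x (outputN x z).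
Proof.
have [c hc] : exists c, forall x z, searchN x z ->
    (forall i, i < z -> ~~ searchN x i) -> computes c x z.
  apply: comp_mu; rewrite /searchN /tilesN /inA /inB /inFH /inFY.
  by comp_with ltac:(fun _ => apply comp_tableP).
have [d hd] : computable (fun e => outputN (nfst e) (nsnd e)).
  rewrite /outputN /tilesN /inA /inB /inFY.
  by comp_with ltac:(fun _ => apply comp_badwordsN).
have [i hi] := comp_id.
exists (RComp d (RPair i c)) => x z h1 h2; exists (npair x z).
  by exists x, z; split=> //; exact: hc.
by have := hd (npair x z); rewrite nfstE nsndE.
Qed.

(** * Locally determined sets and maps of configurations *)

Local Open Scope classical_set_scope.
Local Open Scope ring_scope.

Lemma conf2_nbhs_agree (A : finType) (s : seq (int * int)) (x : conf2 A) :
  nbhs x [set x' : conf2 A | forall k, k \in s -> x' k = x k].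
Proof.
elim: s => [|k s IH].
  by apply: filterS filterT.
have h : nbhs x [set x' : conf2 A | x' k = x k].
  have := @proj_continuous _ (fun _ : int * int => discrete_topology A) k x
    [set (x k : discrete_topology A)].
  by apply; exact: discrete_set1.
apply: filterS2 h IH => x' h1 h2 j; rewrite inE => /orP[/eqP->//|].
exact: h2.
Qed.

Lemma set_type_nbhs_agree (A : finType) (X : set (conf2 A)) (s : seq (int * int))
    (z : set_type X) :
  nbhs z [set z' : set_type X | forall k, k \in s -> set_val z' k = set_val z k].
Proof.
exact: (@initial_continuous (set_type X) (conf2 A) set_val z _
  (conf2_nbhs_agree s (set_val z))).
Qed.

Lemma locally_determined_open (A : finType) (X : set (conf2 A)) (P : set (set_type X))
    (s : seq (int * int)) :
  (forall z z' : set_type X,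
     (forall k, k \in s -> set_val z' k = set_val z k) -> P z -> P z') -> open P.
Proof.
move=> h; rewrite openE => z Pz; apply: filterS (set_type_nbhs_agree s z) => z' zz'.
exact: h zz' Pz.
Qed.

(** Agreement on [s] is symmetric, so the complement is determined by the same cells. *)
Lemma locally_determined_clopen (A : finType) (X : set (conf2 A))
    (P : set (set_type X)) (s : seq (int * int)) :
  (forall z z' : set_type X,
     (forall k, k \in s -> set_val z' k = set_val z k) -> P z -> P z') -> clopen P.
Proof.
move=> h; split; first exact: locally_determined_open h.
rewrite -openC; apply: (@locally_determined_open _ _ _ s) => z z' zz' nP Pz'.
by apply: nP; apply: h Pz' => k ks; rewrite zz'.
Qed.

Lemma locally_determined_continuous (A B : finType) (X : set (conf2 A))
    (Y : set (conf2 B)) (f : set_type X -> set_type Y) :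
  (forall k, exists s : seq (int * int), forall z z' : set_type X,
     (forall j, j \in s -> set_val z' j = set_val z j) ->
     set_val (f z') k = set_val (f z) k) -> continuous f.
Proof.
move=> h; apply: (@continuous_comp_initial _ _ _ (set_val : set_type Y -> conf2 B)).
move=> z; apply/cvg_sup; first exact/fmap_filter/(nbhs_filter z).
move=> k U.
move=> [_ [[V oV <-]] /= Vz] VU.
have [s hs] := h k.
apply: (@filterS _ (nbhs z) _ _ _ _ (set_type_nbhs_agree s z)) => z' /hs e /=.
by apply: VU; rewrite /= e.
Qed.

(** * A table makes the combined subshift a root *)

Definition zrem (n : nat) (h : int) : nat := `|(h %% n%:Z)%Z|%N.

Lemma zrem_lt n h : (0 < n)%N -> (zrem n h < n)%N.
Proof.
move=> n0; have hn : n%:Z != 0 by lia.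
by rewrite -ltz_nat /zrem gez0_abs ?modz_ge0 //; have := ltz_mod h hn; lia.
Qed.

Lemma zdiv_eq n h : (0 < n)%N -> h = (h %/ n%:Z)%Z * n%:Z + (zrem n h)%:Z.
Proof.
by move=> n0; rewrite /zrem gez0_abs; [exact: divz_eq|apply: modz_ge0; lia].
Qed.

Lemma zdiv_unique n (h q : int) (r : nat) : (r < n)%N -> h = q * n%:Z + r%:Z ->
  (h %/ n%:Z)%Z = q /\ zrem n h = r.
Proof.
move=> rn ->; have n0 : n%:Z != 0 by lia.
rewrite divzMDl // divz_small ?addr0; last by lia.
by rewrite /zrem modzMDl modz_small //; lia.
Qed.

Lemma zrem_eq n h h' q : (0 < n)%N -> h = h' + q * n%:Z -> zrem n h = zrem n h'.
Proof.
move=> n0 ->; have := zdiv_unique (zrem_lt h' n0) (q := (h' %/ n%:Z)%Z + q).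
move=> /(_ (h' + q * n%:Z)) [|//]; rewrite {1}[h'](zdiv_eq h' n0); ring.
Qed.

Lemma zrem_eqE n h h' : (0 < n)%N -> zrem n h = zrem n h' ->
  exists q, h = h' + q * n%:Z.
Proof.
move=> n0 hh; exists ((h %/ n%:Z)%Z - (h' %/ n%:Z)%Z).
by rewrite {1}[h](zdiv_eq h n0) {1}[h'](zdiv_eq h' n0) hh; ring.
Qed.

Lemma zrem_nat n k : zrem n k%:Z = (k %% n)%N.
Proof. by rewrite /zrem modz_nat. Qed.

Lemma zrem_small n k : (k < n)%N -> zrem n k%:Z = k.
Proof. by move=> kn; rewrite zrem_nat modn_small. Qed.

Lemma zrem_add n h k : (0 < n)%N -> zrem n (h + k%:Z) = ((zrem n h + k) %% n)%N.
Proof.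
move=> n0; rewrite -zrem_nat; apply: (@zrem_eq _ _ _ (h %/ n%:Z)%Z) => //.
by rewrite {1}[h](zdiv_eq h n0) PoszD; ring.
Qed.

Lemma zdiv_add n h k : (0 < n)%N ->
  ((h + k%:Z) %/ n%:Z)%Z = (h %/ n%:Z)%Z + ((zrem n h + k) %/ n)%N%:Z.
Proof.
move=> n0; apply: proj1 (zdiv_unique (r := ((zrem n h + k) %% n)%N) _ _).
  by rewrite ltn_mod.
rewrite {1}[h](zdiv_eq h n0) mulrDl -!addrA; congr (_ + _).
by rewrite -PoszM -!PoszD -divn_eq.
Qed.

Lemma int_step_ind (P : int -> Prop) : P 0 -> (forall h, P h -> P (h + 1)) ->
  (forall h, P h -> P (h - 1)) -> forall h, P h.
Proof.
move=> P0 Pp Pm; elim/int_ind => // k Pk; first by rewrite intS addrC; apply: Pp.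
by rewrite intS opprD addrC; apply: Pm.
Qed.

Lemma int2_addE (a b c d : int) : (a, b) + (c, d) = (a + c, b + d).
Proof. by []. Qed.

Lemma int2_subE (a b c d : int) : (a, b) - (c, d) = (a - c, b - d).
Proof. by []. Qed.

Lemma zero_in1 : -1 <= (0 : int) <= 1.
Proof. by []. Qed.

Section Root.
Variables (A B : finType) (E : rel A) (T : Type) (R : nat).
Variables (dg : T -> nat -> B) (til : (nat -> B) -> T).
Hypothesis dg_til : forall s x, (x <= 2 * R)%N -> dg (til s) x = s x.
Hypothesis dg_ext : forall t t',
  (forall x, (x <= 2 * R)%N -> dg t x = dg t' x) -> t = t'.
Variable FY : seq (pattern B).
Hypothesis FY_bound : forall p c, p \in FY -> c \in p ->
  (`|c.1.1| <= R)%N /\ (`|c.1.2| <= R)%N.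
Variables (m n : nat) (F : nat -> nat -> T -> A).

Definition shifted_tile t t' := forall x, (x < 2 * R)%N -> dg t x.+1 = dg t' x.

Definition synchronized := forall i j psi,
  (i < m)%N -> (j < m)%N -> (psi < n)%N -> (j, psi) != ((i.+1 %% m)%N, 0%N) ->
  exists2 r, (r < n)%N & forall t t', ~~ E (F r i t) (F ((r + psi) %% n)%N j t').

Definition transmitting := forall i t t', (i < m)%N ->
  (forall r, (r < n)%N -> E (F r i t) (F r (i.+1 %% m)%N t')) <->
  (if i.+1 == m then shifted_tile t t' else t = t').

Hypotheses (m1 : (1 < m)%N) (n0 : (0 < n)%N).
Hypotheses (sync : synchronized) (transm : transmitting).

(** A forbidden pattern spans at most [2 * R + 1] blocks in height; the margin makes these whole
    blocks at every phase. *)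
Definition window := (2 * R + 3)%N.

(** Tile 0 may be cut by the end of the window, so patterns are sought from tile 1 on. By
    [FY_bound], the integers under the absolute values are nonnegative. *)
Definition valid_stack (S : nat -> T) := forall p, p \in FY ->
  ~ forall c, c \in p -> dg (S `|R%:Z + c.1.2|.+1) `|R%:Z + c.1.1| = c.2.

Definition reads (u : nat -> A) j phi S := [/\ (j < m)%N, (phi < n)%N, valid_stack S &
  forall y, (y < window * n)%N -> u y = F ((y + phi) %% n)%N j (S ((y + phi) %/ n)%N)].

Definition Hset : set (int -> A) := [set x | forall i, E (x i) (x (i + 1))].

Definition Vset : set (int -> A) :=
  [set x | forall y0 : int, exists j phi S, reads (fun y => x (y0 + y%:Z)) j phi S].

Let X := combined Hset Vset.
Let Y := sft2 FY.

(** Each letter of [y] becomes an [m] by [n] rectangle. Its tile also records [R] letters on either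
    side, so that a single column sees enough of [y] to exclude the forbidden patterns. *)
Definition enc (y : conf2 B) : conf2 A := fun k =>
  F (zrem n k.2) (zrem m k.1)
    (til (fun x => y ((k.1 %/ m%:Z)%Z + x%:Z - R%:Z, (k.2 %/ n%:Z)%Z))).

Let m0 : (0 < m)%N. Proof. by lia. Qed.

Lemma enc_reads y i0 y0 : Y y ->
  reads (fun k => enc y (i0, y0 + k%:Z)) (zrem m i0) (zrem n y0)
    (fun k => til (fun x =>
       y ((i0 %/ m%:Z)%Z + x%:Z - R%:Z, (y0 %/ n%:Z)%Z + k%:Z))).
Proof.
move=> Yy; split; [exact: zrem_lt|exact: zrem_lt| |].
  move=> p pF h; apply: (Yy p ((i0 %/ m%:Z)%Z, (y0 %/ n%:Z)%Z + 1 + R%:Z) pF).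
  move=> [[c1 c2] b] cp; have [/= h1 h2] := FY_bound pF cp.
  have := h _ cp; rewrite dg_til /=; last by lia.
  move=> <-; rewrite int2_addE; congr (y (_, _)); lia.
move=> k kw; rewrite /enc /= zrem_add // zdiv_add //.
by rewrite ![(k + _)%N]addnC.
Qed.

Lemma enc_combined y : Y y -> X (enc y).
Proof.
move=> Yy i0 j0; split=> [i|y0]; last first.
  by do 3 eexists; exact: enc_reads.
rewrite /enc /=; have := zrem_lt i m0 => im.
have -> : zrem m (i + 1) = ((zrem m i).+1 %% m)%N by rewrite zrem_add // addn1.
have -> : ((i + 1) %/ m%:Z)%Z = (i %/ m%:Z)%Z + ((zrem m i).+1 %/ m)%N%:Z.
  by rewrite zdiv_add // addn1.
move: (zrem_lt j0 n0); move: (zrem n j0); apply/transm => //.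
case: eqP => [im1 x xR|/eqP im1].
  rewrite !dg_til; [|lia|lia]; congr (y (_, _)).
  by rewrite im1 divnn m0 -[x.+1]addn1 PoszD; lia.
by rewrite divn_small ?addr0 //; lia.
Qed.

(** Equal blocks are compatible with the same neighbours, and a neighbour transmits the tile. For
    type [m - 1] the preceding column is used, since the following one only sees an overlap. *)
Lemma F_inj j t t' : (j < m)%N -> (forall r, (r < n)%N -> F r j t = F r j t') -> t = t'.
Proof.
move=> jm h; have [jm1|jm1] := eqVneq j.+1 m.
  have j1 : (j.-1 < m)%N by lia.
  have j1S : (j.-1.+1 %% m)%N = j by rewrite prednK ?modn_small //; lia.
  have := (transm t t j1).2; have := (transm t t' j1).1; rewrite j1S.
  have -> : j.-1.+1 == m = false by lia.
  move=> h1 h2; apply: h1 => r rn; rewrite -h //; exact: h2.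
have j1S : (j.+1 %% m)%N = j.+1 by rewrite modn_small //; lia.
have := (transm t t jm).2; have := (transm t' t jm).1; rewrite j1S (negbTE jm1).
by move=> h1 h2; apply/esym/h1 => r rn; rewrite -h //; exact: h2.
Qed.

Lemma enc_inj : injective enc.
Proof.
move=> y y' yy'; apply/funext => -[a b].
have h : til (fun x => y (a + x%:Z - R%:Z, b)) = til (fun x => y' (a + x%:Z - R%:Z, b)).
  apply: (@F_inj 0) => // r rn.
  have := congr1 (fun f => f (a * m%:Z, b * n%:Z + r%:Z)) yy'; rewrite /enc /=.
  have [-> ->] := zdiv_unique rn (erefl (b * n%:Z + r%:Z)).
  by have [-> ->] := zdiv_unique m0 (esym (addr0 (a * m%:Z))).
have := congr1 (fun t => dg t R) h; rewrite !dg_til; [|lia|lia].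
by have -> : a + R%:Z - R%:Z = a by lia.
Qed.

Lemma enc_shift k1 k2 y :
  enc (shift2 (k1, k2) y) = shift2 (k1 * m%:Z, k2 * n%:Z) (enc y).
Proof.
apply/funext => -[a b]; rewrite /enc /shift2 /=.
have [-> ->] : ((a - k1 * m%:Z) %/ m%:Z)%Z = (a %/ m%:Z)%Z - k1 /\
    zrem m (a - k1 * m%:Z) = zrem m a.
  by apply: zdiv_unique; [exact: zrem_lt|rewrite {1}[a](zdiv_eq a m0); ring].
have [-> ->] : ((b - k2 * n%:Z) %/ n%:Z)%Z = (b %/ n%:Z)%Z - k2 /\
    zrem n (b - k2 * n%:Z) = zrem n b.
  by apply: zdiv_unique; [exact: zrem_lt|rewrite {1}[b](zdiv_eq b n0); ring].
congr (F _ _ (til _)); apply/funext => x; congr (y (_, _)); rewrite /=; lia.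
Qed.

(** * Readings of the columns and their propagation *)

Definition rd (x : conf2 A) (c y0 : int) j phi :=
  exists S, reads (fun y => x (c, y0 + y%:Z)) j phi S.

Lemma rd_exists x c y0 : X x -> exists j phi, rd x c y0 j phi.
Proof.
by move=> /(_ c 0)[_ /(_ y0) [j [phi [S h]]]]; exists j, phi, S.
Qed.

(** Otherwise synchronization gives a row [r] without any edge, and both windows are long enough to
    contain it. *)
Lemma rd_next x c y0 (d : int) j phi j' phi' : X x -> -1 <= d <= 1 ->
    rd x c y0 j phi -> rd x (c + 1) (y0 + d) j' phi' ->
  j' = (j.+1 %% m)%N /\ phi' = zrem n (phi%:Z + d).
Proof.
move=> Xx d1 [S [jm phin _ rS]] [S' [jm' phin' _ rS']].
pose psi := zrem n (phi'%:Z - phi%:Z - d).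
have [[-> psi0]|ne] := eqVneq (j', psi) ((j.+1 %% m)%N, 0%N).
  split=> //; rewrite -[LHS](zrem_small phin').
  have : zrem n (phi'%:Z - phi%:Z - d) = zrem n 0%:Z by rewrite -/psi psi0 zrem_nat mod0n.
  move=> /(zrem_eqE n0)[q hq]; apply: (@zrem_eq _ _ _ q) => //; lia.
have [r rn nE] := sync jm jm' (zrem_lt _ n0) ne.
(* The row is sought from height 1 on, so that [1 + y1 - d] is not negative. *)
pose y1 := zrem n (r%:Z - phi%:Z - 1).
have y1n := zrem_lt (r%:Z - phi%:Z - 1) n0; rewrite -/y1 in y1n.
have yr : (((1 + y1) + phi) %% n)%N = r.
  rewrite -zrem_nat -[RHS](zrem_small rn).
  have := zdiv_eq (r%:Z - phi%:Z - 1) n0; rewrite -/y1 => e.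
  apply: (@zrem_eq _ _ _ (- ((r%:Z - phi%:Z - 1) %/ n%:Z)%Z)) => //.
  by rewrite mulNr; lia.
have W2 : (3 * n <= window * n)%N by rewrite leq_mul2r /window; lia.
have /rS e1 : (1 + y1 < window * n)%N by apply: leq_trans W2; lia.
pose y2 := `|(1 + y1)%N%:Z - d|%N.
have /rS' e2 : (y2 < window * n)%N by apply: leq_trans W2; rewrite /y2; lia.
have := (Xx 0 (y0 + (1 + y1)%N%:Z)).1 c.
rewrite e1 yr; have -> : y0 + (1 + y1)%N%:Z = y0 + d + y2%:Z by lia.
rewrite e2.
have -> : ((y2 + phi') %% n)%N = ((r + psi) %% n)%N.
  rewrite -zrem_nat -(zrem_nat n (r + psi)).
  have e := zdiv_eq (phi'%:Z - phi%:Z - d) n0; rewrite -/psi in e.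
  have e' := divn_eq (1 + y1 + phi) n; rewrite yr in e'.
  apply: (@zrem_eq _ _ _ (((phi'%:Z - phi%:Z - d) %/ n%:Z)%Z + ((1 + y1 + phi) %/ n)%N%:Z)) => //.
  rewrite mulrDl -PoszM; lia.
by rewrite (negbTE (nE _ _)).
Qed.

Lemma modS_inj j j' : (j < m)%N -> (j' < m)%N -> (j.+1 %% m = j'.+1 %% m)%N -> j = j'.
Proof.
move=> jm jm' h; have : (j == j' %[mod m])%N by rewrite -(eqn_modDr 1) !addn1 h.
by rewrite !modn_small // => /eqP.
Qed.

Lemma rd_lt x c y0 j phi : rd x c y0 j phi -> (j < m)%N /\ (phi < n)%N.
Proof. by move=> [S []]. Qed.

(** Both windows are compared with one reading of the column to the right. For [d = 0] this is the
    uniqueness of readings. *)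
Lemma rd_up x c y0 (d : int) j phi j' phi' : X x -> -1 <= d <= 1 ->
  rd x c y0 j phi -> rd x c (y0 + d) j' phi' -> j' = j /\ phi' = zrem n (phi%:Z + d).
Proof.
move=> Xx d1 r1 r2; have [j3 [phi3 r3]] := rd_exists (c + 1) y0 Xx.
have [jm phin] := rd_lt r1; have [jm' phin'] := rd_lt r2.
have r30 : rd x (c + 1) (y0 + 0) j3 phi3 by rewrite addr0.
have [h1 h2] := rd_next Xx zero_in1 r1 r30.
have r31 : rd x (c + 1) (y0 + d - d) j3 phi3 by rewrite addrK.
have d1' : -1 <= - d <= 1 by lia.
have [h3 h4] := rd_next Xx d1' r2 r31.
split; first by apply: modS_inj => //; rewrite -h1 h3.
rewrite -(zrem_small phin'); rewrite h2 addr0 in h4.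
have [q hq] := zrem_eqE n0 (esym h4); apply: (@zrem_eq _ _ _ q) => //; lia.
Qed.

Lemma rd_all x j phi c y0 j' phi' : X x -> rd x 0 0 j phi -> rd x c y0 j' phi' ->
  j' = zrem m (c + j%:Z) /\ phi' = zrem n (y0 + phi%:Z).
Proof.
move=> Xx r0; have [jm phin] := rd_lt r0.
have col0 : forall y0 j' phi', rd x 0 y0 j' phi' -> j' = j /\ phi' = zrem n (y0 + phi%:Z).
  have step (d : int) h : -1 <= d <= 1 ->
      (forall j' phi', rd x 0 h j' phi' -> j' = j /\ phi' = zrem n (h + phi%:Z)) ->
      forall j' phi', rd x 0 (h + d) j' phi' -> j' = j /\ phi' = zrem n (h + d + phi%:Z).
    move=> d1 IH j2 phi2 r2; have [j1 [phi1 r1]] := rd_exists 0 h Xx.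
    have [<- e1] := IH _ _ r1; have [-> ->] := rd_up Xx d1 r1 r2; split=> //.
    have := zdiv_eq (h + phi%:Z) n0; rewrite -e1 => e.
    by apply: (@zrem_eq _ _ _ (- ((h + phi%:Z) %/ n%:Z)%Z)) => //; rewrite mulNr; lia.
  elim/int_step_ind => [j2 phi2 r2|h IH|h IH]; [|exact: step|exact: step].
  have r20 : rd x 0 (0 + 0) j2 phi2 by rewrite addr0.
  by have [-> ->] := rd_up Xx zero_in1 r0 r20; rewrite addr0 add0r.
elim/int_step_ind: c j' phi' => [j2 phi2 /col0[-> ->]|c IH j2 phi2 r2|c IH j2 phi2 r2].
- by rewrite add0r zrem_small.
- have [j1 [phi1 r1]] := rd_exists c y0 Xx; have [e1 e2] := IH _ _ r1.
  have r20 : rd x (c + 1) (y0 + 0) j2 phi2 by rewrite addr0.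
  have [-> ->] := rd_next Xx zero_in1 r1 r20.
  have [_ phi1n] := rd_lt r1.
  have -> : c + 1 + j%:Z = c + j%:Z + 1%N%:Z by lia.
  by rewrite addr0 zrem_small // -e2 e1 (zrem_add _ 1) // addn1.
- have [j1 [phi1 r1]] := rd_exists c y0 Xx; have [e1 e2] := IH _ _ r1.
  have r10 : rd x (c - 1 + 1) (y0 + 0) j1 phi1 by rewrite addr0 subrK.
  have [h1 h2] := rd_next Xx zero_in1 r2 r10.
  have [j2m phi2n] := rd_lt r2; rewrite addr0 zrem_small // in h2.
  split; last by rewrite -e2.
  apply: modS_inj => //; first exact: zrem_lt.
  by rewrite -h1 e1 -addn1 -zrem_add //; congr zrem; lia.
Qed.

Definition aligned x := rd x 0 0 0 0.

Lemma enc_aligned y : Y y -> aligned (enc y).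
Proof.
move=> Yy; have := enc_reads 0 0 Yy; rewrite !(zrem_nat _ 0) !mod0n.
by move=> h; eexists; exact: h.
Qed.

(* An aligned point of X is read off block by block: t c k is the tile that
   column c carries in the rows [k n, (k + 1) n). *)
Lemma aligned_enc x : X x -> aligned x -> exists2 y, Y y & x = enc y.
Proof.
move=> Xx al.
have /choice[St StP] : forall p : int * int, exists S,
    reads (fun y => x (p.1, p.2 * n%:Z + y%:Z)) (zrem m p.1) 0 S.
  move=> [c k] /=; have [j [phi r]] := rd_exists c (k * n%:Z) Xx.
  have [e1 e2] := rd_all Xx al r; move: r; rewrite e1 e2 !addr0.
  by have [_ ->] := zdiv_unique n0 (esym (addr0 (k * n%:Z))).
pose t c k := St (c, k - 1) 1%N.
have wn s r : (s <= 2 * R + 2)%N -> (r < n)%N -> (s * n + r < window * n)%N.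
  move=> sR rn; apply: leq_trans (_ : s.+1 * n <= _)%N.
    by rewrite mulSn addnC -addSn leq_add2r.
  by rewrite leq_mul2r /window; lia.
have rdx c k s r : (s <= 2 * R + 2)%N -> (r < n)%N ->
    x (c, (k + s%:Z) * n%:Z + r%:Z) = F r (zrem m c) (St (c, k) s).
  move=> sR rn; have [_ _ _ /(_ _ (wn _ _ sR rn)) /=] := StP (c, k).
  rewrite addn0 modnMDl modn_small // divnMDl // divn_small // addn0 => <-.
  by congr (x (_, _)); rewrite PoszD PoszM mulrDl addrA.
have xt c k r : (r < n)%N -> x (c, k * n%:Z + r%:Z) = F r (zrem m c) (t c k).
  by move=> rn; rewrite /t -rdx //; [congr (x (_, _ * _ + _)); lia|lia].
(* The stacks are chosen separately for each window; they agree on common blocks because a whole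
   block determines its tile. *)
have Stt c k s : (s <= 2 * R + 2)%N -> St (c, k) s = t c (k + s%:Z).
  move=> sR; apply: (@F_inj (zrem m c)); first exact: zrem_lt.
  by move=> r rn; rewrite -rdx // xt.
have tnext c k : if (zrem m c).+1 == m then shifted_tile (t c k) (t (c + 1) k)
    else t c k = t (c + 1) k.
  apply/transm; first exact: zrem_lt.
  move=> r rn; rewrite -[(zrem m c).+1]addn1 -zrem_add // -!xt //.
  exact: (Xx 0 (k * n%:Z + r%:Z)).1.
pose th a k := t (a * m%:Z) k.
have zr a i : (i < m)%N -> zrem m (a * m%:Z + i%:Z) = i.
  by move=> im; have [] := zdiv_unique im (erefl (a * m%:Z + i%:Z)).
have tth a i k : (i < m)%N -> t (a * m%:Z + i%:Z) k = th a k.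
  elim: i => [|i IH] im; first by rewrite addr0.
  rewrite -IH; last by lia.
  have := tnext (a * m%:Z + i%:Z) k; rewrite zr; last by lia.
  have -> : i.+1 == m = false by lia.
  by move=> ->; rewrite -addrA -PoszD addn1.
have thS a k : shifted_tile (th a k) (th (a + 1) k).
  have := tnext (a * m%:Z + m.-1%:Z) k; rewrite zr; last by lia.
  rewrite prednK // eqxx tth; last by lia.
  have -> : a * m%:Z + m.-1%:Z + 1 = (a + 1) * m%:Z by rewrite mulrDl mul1r; lia.
  by [].
have thD a k u d : (u + d <= 2 * R)%N -> dg (th a k) (u + d)%N = dg (th (a + d%:Z) k) u.
  elim: d a => [|d IH] a ud; first by rewrite addn0 addr0.
  rewrite addnS thS; last by lia.
  rewrite IH; last by lia.
  by congr (dg (th _ _) _); lia.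
(* The letter is the middle of the tile; by [thD] the other letters of a tile are the middles of its
   neighbours. *)
pose y : conf2 B := fun p => dg (th p.1 p.2) R.
have thy a k u : (u <= 2 * R)%N -> dg (th a k) u = y (a + u%:Z - R%:Z, k).
  move=> uR; rewrite /y /=; have [Ru|uR'] := leqP R u.
    have {1}-> : u = (R + (u - R))%N by lia.
    by rewrite thD; [congr (dg (th _ _) _)|]; lia.
  have {2}-> : R = (u + (R - u))%N by lia.
  by rewrite thD; [congr (dg (th _ _) _)|]; lia.
exists y.
  move=> p [a k] pF pat; have [_ _ val _] := StP (a * m%:Z, k - R%:Z - 1).
  apply: (val p pF) => -[[c1 c2] b] cp; have [/= h1 h2] := FY_bound pF cp.
  rewrite Stt; last by lia.
  rewrite -/(th _ _) thy; last by lia.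
  have /= <- := pat _ cp; rewrite int2_addE; congr (y (_, _)); lia.
apply/funext => -[c h]; rewrite /enc /=.
rewrite {1}(zdiv_eq h n0) xt ?zrem_lt //; congr (F _ _ _).
rewrite {1}(zdiv_eq c m0) tth ?zrem_lt //; apply: dg_ext => u uR.
by rewrite dg_til // thy.
Qed.

(** * The clopen set of aligned points and the root property *)

Let Z : set (conf2 A) := enc @` Y.

Lemma ZP x : Z x <-> X x /\ aligned x.
Proof.
split=> [[y Yy <-]|[Xx /(aligned_enc Xx)[y Yy ->]]]; last by exists y.
by split; [exact: enc_combined|exact: enc_aligned].
Qed.

Lemma shift2D (C : finType) (u v : int * int) (x : conf2 C) :
  shift2 u (shift2 v x) = shift2 (u + v) x.
Proof. by apply/funext => k; rewrite /shift2 opprD addrA. Qed.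

Lemma shift2_0 (C : finType) (x : conf2 C) : shift2 0 x = x.
Proof. by apply/funext => k; rewrite /shift2 subr0. Qed.

Lemma sft2_shift v y : Y y -> Y (shift2 v y).
Proof.
move=> Yy p u pF h; apply: (Yy p (u - v) pF) => c cp.
by rewrite -(h c cp) /shift2 addrAC.
Qed.

Lemma combined_shift v x : X x -> X (shift2 v x).
Proof.
case: v => v1 v2 Xx i j; split=> [k|y0].
  have := (Xx i (j - v2)).1 (k - v1); rewrite /shift2 !int2_subE.
  by have -> : k - v1 + 1 = k + 1 - v1 by lia.
have [_ /(_ (y0 - v2))[a [b [c h]]]] := Xx (i - v1) 0; exists a, b, c.
rewrite [X in reads X](_ : _ = fun y => x (i - v1, y0 - v2 + y%:Z)) //.
by apply/funext => y; rewrite /shift2 int2_subE; congr (x (_, _)); lia.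
Qed.

Lemma rd_shift x v1 v2 c y0 j phi :
  rd x (c - v1) (y0 - v2) j phi -> rd (shift2 (v1, v2) x) c y0 j phi.
Proof.
move=> [S h]; exists S.
rewrite [X in reads X](_ : _ = fun y => x (c - v1, y0 - v2 + y%:Z)) //.
by apply/funext => y; rewrite /shift2 int2_subE; congr (x (_, _)); lia.
Qed.

Theorem table_root : is_root m n X Y.
Proof.
exists Z; split.
- split; first by move=> x /ZP[].
  (* Within [X], being aligned depends on one window of column 0 only. *)
  pose s := [seq (0 : int, (Posz y)) | y <- iota 0 (window * n)].
  apply: (@locally_determined_clopen _ _ _ s) => z z' zz' /ZP[_ [S [jm phin val hS]]].
  apply/ZP; split; first exact: set_valP.
  exists S; split=> // y yw; rewrite -hS //.
  by rewrite zz' // !add0r; apply/mapP; exists y; rewrite // mem_iota.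
- have zsh v : shift2 (v.1 * m%:Z, v.2 * n%:Z) @` Z `<=` Z.
    move=> _ [_ [y Yy <-] <-]; exists (shift2 v y); first exact: sft2_shift.
    by case: v => v1 v2; rewrite enc_shift.
  have zeq v : shift2 (v.1 * m%:Z, v.2 * n%:Z) @` Z = Z.
    apply/seteqP; split=> [|z Zz]; first exact: zsh.
    exists (shift2 ((- v).1 * m%:Z, (- v).2 * n%:Z) z).
      by apply: (zsh (- v)); exists z.
    by rewrite shift2D int2_addE /= !mulNr !subrr shift2_0.
  split; first by have := zeq (1, 0); rewrite /= mul1r mul0r.
  by have := zeq (0, 1); rewrite /= mul1r mul0r.
- have /choice[phi phiP] : forall z : set_type Z, exists y : set_type Y,
      enc (set_val y) = set_val z.
    move=> z; have [y Yy e] : Z (set_val z) by exact: set_valP.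
    by exists (SigSub (mem_set Yy)).
  have Zenc (y : set_type Y) : Z (enc (set_val y)).
    by exists (set_val y) => //; exact: set_valP.
  exists phi; split; last first.
    move=> x x' k1 k2 e; apply: enc_inj.
    by rewrite enc_shift !phiP.
  split.
    apply: locally_determined_continuous => -[a b].
    (* One column of the block determines its tile, whose middle letter is the letter at
       [(a, b)]. *)
    exists [seq (a * m%:Z, b * n%:Z + Posz r) | r <- iota 0 n] => z z' zz'.
    pose y := set_val (phi z); pose y' := set_val (phi z').
    have h : til (fun x => y' (a + x%:Z - R%:Z, b)) = til (fun x => y (a + x%:Z - R%:Z, b)).
      apply: (@F_inj 0) => // r rn.
      have := zz' (a * m%:Z, b * n%:Z + r%:Z); rewrite -!phiP /enc /=.
      have [-> ->] := zdiv_unique rn (erefl (b * n%:Z + r%:Z)).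
      have [-> ->] := zdiv_unique m0 (esym (addr0 (a * m%:Z))); apply.
      by apply/mapP; exists r; rewrite // mem_iota.
    have := congr1 (fun t => dg t R) h; rewrite !dg_til; [|lia|lia].
    by have -> : a + R%:Z - R%:Z = a by lia.
  exists (fun y => SigSub (mem_set (Zenc y))); split.
  + by move=> z; apply: val_inj; rewrite /= phiP.
  + by move=> y; apply: val_inj; apply: enc_inj; rewrite phiP.
  + apply: locally_determined_continuous => -[a b].
    exists [seq ((a %/ m%:Z)%Z + Posz x - R%:Z, (b %/ n%:Z)%Z) | x <- iota 0 (2 * R).+1].
    move=> z z' zz'; rewrite /set_val /= /enc /=; congr (F _ _ _).
    apply: dg_ext => x xR; rewrite !dg_til //; apply: zz'.
    by apply/mapP; exists x; rewrite // mem_iota add0n ltnS.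
- split.
    apply/seteqP; split=> [x Xx|x [[i j] _ [z /ZP[Xz _] <-]]]; last first.
      exact: combined_shift.
    have [j [phi r]] := rd_exists 0 0 Xx; have [jm phin] := rd_lt r.
    pose i1 := Ordinal (ltn_pmod (m - j) m0); pose i2 := Ordinal (ltn_pmod (n - phi) n0).
    exists (i1, i2) => //; exists (shift2 (- (i1%:Z), - (i2%:Z)) x); last first.
      by rewrite shift2D int2_addE /= !subrr shift2_0.
    apply/ZP; split; first exact: combined_shift.
    apply: rd_shift; rewrite !add0r !opprK.
    have [j' [phi' r']] := rd_exists i1%:Z i2%:Z Xx.
    have [e1 e2] := rd_all Xx r r'; move: r'; rewrite e1 e2 -!PoszD !zrem_nat /=.
    by rewrite !modnDml !subnK ?modnn // ltnW.
  (* A point of two translates has reading [(0, 0)] at both offsets, which are then congruent by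
     [rd_all]. *)
  apply/trivIsetP => -[i j] [i' j'] _ _ ne; apply/seteqP; split=> // x.
  move=> [[z /ZP[Xz az] zx] [z' /ZP[Xz' az'] z'x]].
  have Xx : X x by rewrite -zx; exact: combined_shift.
  have [j0 [phi0 r0]] := rd_exists 0 0 Xx.
  have rz : rd x i%:Z j%:Z 0 0 by rewrite -zx; apply: rd_shift; rewrite !subrr.
  have rz' : rd x i'%:Z j'%:Z 0 0 by rewrite -z'x; apply: rd_shift; rewrite !subrr.
  have [h1 h2] := rd_all Xx r0 rz; have [h3 h4] := rd_all Xx r0 rz'.
  have {h1 h3} := etrans (esym h1) h3; have {h2 h4} := etrans (esym h2) h4.
  rewrite -!PoszD !zrem_nat => /eqP h2 /eqP h1.
  move: ne; rewrite xpair_eqE -!val_eqE /=.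
  by move: h1 h2; rewrite !eqn_modDr !modn_small // => /eqP-> /eqP->; rewrite !eqxx.
Qed.

End Root.

Local Close Scope ring_scope.

(** * From the graph of H to the program *)

Definition letter (C : finType) (c0 : C) (k : nat) : C := nth c0 (enum C) k.

Lemma code_letter_lt (C : finType) (c : C) : code_letter c < #|C|.
Proof. exact: ltn_ord. Qed.

Lemma code_letter_inj (C : finType) : injective (@code_letter C).
Proof. by move=> x y /val_inj /enum_rank_inj. Qed.

Lemma code_letterK (C : finType) (c0 c : C) : letter c0 (code_letter c) = c.
Proof. by rewrite /letter /code_letter nth_enum_rank. Qed.

Lemma letterK (C : finType) (c0 : C) k : k < #|C| -> code_letter (letter c0 k) = k.
Proof.
move=> kC; rewrite /letter -[k]/(val (Ordinal kC)) -enum_val_nth /code_letter.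
by rewrite enum_valK.
Qed.

Section Edges.
Variables (A : finType) (FH : seq (seq A)).

(** This is what the program can test. It may exceed the Rauzy graph, as an allowed pair need not
    extend to a configuration. *)
Definition allowed : rel A := fun a b => [:: a; b] \notin FH.

Lemma edgeNE a b : edgeN (code_words FH) (code_letter a) (code_letter b) = allowed a b.
Proof.
apply/idP/idP.
  move=> /bforallP h; apply/negP => abF.
  have iF : index [:: a; b] FH < size FH by rewrite index_mem.
  have := h _ (leq_trans iF (size_leq_code _ _)).
  by rewrite (cnthE _ [::]) // nth_index //= eqxx.
move=> abF; apply/bforallP => i _; case: (ltnP i (size FH)) => iF; last first.
  by rewrite cnth_default.
rewrite (cnthE _ [::]) //.
have -> : (npair (code_letter a) (npair (code_letter b) 0).+1).+1 =
  code_seq (@code_letter A) [:: a; b] by [].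
apply: contra abF => /eqP /(code_seq_inj (@code_letter_inj A)) <-.
exact: mem_nth.
Qed.

Lemma sft1_allowed : length2 FH -> sft1 FH = Hset allowed.
Proof.
move=> /allP l2; apply/seteqP; split=> x h.
  move=> i; apply/negP => abF; apply: (h _ i abF).
  by rewrite /word_at /mkseq /= addr0.
move=> w i wF; have /eqP := l2 _ wF; case: w wF => [|a [|b [|]]] // wF _.
by rewrite /word_at /mkseq /= addr0 => -[ea eb]; have := h i; rewrite ea eb /allowed wF.
Qed.

Let ER : rel A := fun a b => `[< rauzy_edge (sft1 FH) a b >].

Lemma rauzy_allowed a b : length2 FH -> ER a b -> allowed a b.
Proof.
move=> l2 /asboolP[x + [i]]; rewrite sft1_allowed // => Hx.
by rewrite /word_at /mkseq /= addr0 => -[<- <-]; exact: Hx.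
Qed.

(* A bi-infinite walk through an allowed edge between two cyclic vertices:
   turn around the first one in the past and the second one in the future. *)
Lemma allowed_rauzy a b k l : length2 FH -> walk ER k.+1 a a -> walk ER l.+1 b b ->
  allowed a b -> ER a b.
Proof.
move=> l2 /walkP[f wf] /walkP[g wg] ab; apply/asboolP.
pose x (i : int) := if (i <= 0)%R then f (zrem k.+1 i) else g (zrem l.+1 (i - 1)%R).
have [f0 _ _] := wf; have [g0 _ _] := wg.
have cf := wfun_closed wf; have cg := wfun_closed wg.
have x0 : x 0%R = a by rewrite /x /= (zrem_nat _ 0) mod0n f0.
have x1 : x 1%R = b by rewrite /x /= subrr (zrem_nat _ 0) mod0n g0.
exists x; last by exists 0%R; rewrite /word_at /mkseq /= x0 x1.
rewrite sft1_allowed // => i.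
have [->|i0] := eqVneq i 0%R; first by rewrite add0r x0 x1.
have [in0|ip] := boolP (i <= 0)%R.
  have e : x (i + 1)%R = f ((zrem k.+1 i).+1 %% k.+1).
    rewrite /x; have -> : (i + 1 <= 0)%R by lia.
    by rewrite (zrem_add _ 1) // addn1.
  rewrite e /x in0; apply: rauzy_allowed => //; apply: cf; exact: zrem_lt.
have e : x (i + 1)%R = g ((zrem l.+1 (i - 1)%R).+1 %% l.+1).
  rewrite /x; have -> : (i + 1 <= 0)%R = false by lia.
  have -> : (i + 1 - 1 = (i - 1) + 1%N%:Z)%R by lia.
  by rewrite (zrem_add _ 1) // addn1.
rewrite e /x (negbTE ip); apply: rauzy_allowed => //; apply: cg; exact: zrem_lt.
Qed.

End Edges.

Lemma mulD_ltn q Q t d : q < Q -> t < d -> q * d + t < Q * d.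
Proof. by nia. Qed.

(** * Numerical tables and the correctness of the program *)

Section Assembly.
Variables (A B : finType) (FH : seq (seq A)) (FY : seq (pattern B)) (a0 : A).
Let R := code_patterns FY.
Let tau := #|B| ^ (2 * R).+1.
Let a := #|A|.
Let b := #|B|.
Let E := allowed FH.
Let cH := code_words FH.

Let a_gt0 : 0 < a. Proof. by apply/card_gt0P; exists a0. Qed.

(** [B] may be empty, but then there is no tile. *)
Lemma tile_card_gt0 (t : 'I_tau) : 0 < b.
Proof.
by have := leq_ltn_trans (leq0n t) (ltn_ord t); rewrite /tau expn_gt0 orbF.
Qed.

Definition tile_letter (t : 'I_tau) (x : nat) : B :=
  enum_val (Ordinal (digit_lt t x (tile_card_gt0 t))).

Lemma tile_letterE t x : code_letter (tile_letter t x) = digit b t x.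
Proof. by rewrite /code_letter enum_valK. Qed.

Definition tile_of (s : nat -> B) : 'I_tau :=
  Ordinal (@undigits_lt b (2 * R).+1 (fun x => code_letter (s x))
    (fun x _ => code_letter_lt (s x))).

Lemma tile_letter_of s x : x <= 2 * R -> tile_letter (tile_of s) x = s x.
Proof.
move=> xR; apply: code_letter_inj; rewrite tile_letterE undigitsK // => i _.
exact: code_letter_lt.
Qed.

Lemma tile_letter_ext t t' :
  (forall x, x <= 2 * R -> tile_letter t x = tile_letter t' x) -> t = t'.
Proof.
move=> h; apply/val_inj/(@digit_ext b (2 * R).+1); try exact: ltn_ord.
by move=> x xR; rewrite -!tile_letterE h.
Qed.

Lemma patterns_bound p c : p \in FY -> c \in p ->
  absz c.1.1 <= R /\ absz c.1.2 <= R.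
Proof.
move=> pF cp; have ci z : absz z <= code_int z by case: z => k /=; lia.
have h := leq_trans (mem_leq_code (code_pair (code_pair code_int code_int)
  (@code_letter B)) cp) (mem_leq_code (code_seq _) pF).
have h1 := leq_trans (leq_npairl _ _) h.
by split; apply: leq_trans (ci _) (leq_trans _ h1); [exact: leq_npairl|exact: leq_npairr].
Qed.

Section FromTable.
Variables m n D : nat.
Hypothesis tabP : tableP cH a b R tau m n D.

Definition tab (r i : nat) (t : 'I_tau) : A := letter a0 (tableN a m tau D r i t).

Let V := Vset R tile_letter FY m n tab.

Lemma tab_edge r i (t : 'I_tau) r' i' (t' : 'I_tau) :
  edgeN cH (tableN a m tau D r i t) (tableN a m tau D r' i' t') =
  E (tab r i t) (tab r' i' t').
Proof. by rewrite /E -edgeNE !letterK // digit_lt. Qed.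

Lemma tab_root : length2 FH -> is_root m n (combined (sft1 FH) V) (sft2 FY).
Proof.
move=> FH2; have /and4P[m1 n0 /bforallP sy /bforallP tr] := tabP.
rewrite (sft1_allowed FH2); apply: (table_root tile_letter_of) => //.
- exact: tile_letter_ext.
- exact: patterns_bound.
- move=> i j psi im jm psin ne.
  have /bforallP/(_ j jm)/bforallP/(_ psi psin) := sy i im.
  rewrite -[_ && _]xpair_eqE (negbTE ne) /= => /bexistsP[r rn h].
  exists r => // t t'.
  by have /bforallP/(_ t (ltn_ord t))/bforallP/(_ t' (ltn_ord t')) := h; rewrite tab_edge.
- move=> i t t' im.
  have /bforallP/(_ t (ltn_ord t))/bforallP/(_ t' (ltn_ord t'))/eqP h := tr i im.
  set P := bforall _ _ in h.
  have PP : P <-> forall r, r < n -> E (tab r i t) (tab r (i.+1 %% m) t').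
    by split=> [/bforallP hP r rn|hP]; [|apply/bforallP => r rn];
      rewrite ?tab_edge -?tab_edge; [apply: hP|rewrite tab_edge; exact: hP].
  rewrite -PP h; case: eqP => im1 /=; last by split=> [/eqP/val_inj|->//].
  rewrite orbF; split=> [/bforallP hs x xR|hs].
    by apply: code_letter_inj; rewrite !tile_letterE; apply/eqP/hs.
  by apply/bforallP => x xR; rewrite -!tile_letterE hs.
Qed.

Lemma posNE (z : int) : absz z <= R -> posN R (code_int z) = absz (R%:Z + z)%R.
Proof.
rewrite /posN; case: z => k /= kR.
  have -> : k.*2 %% 2 = 0 by rewrite -muln2 modnMl.
  by rewrite /nif /= -muln2 mulnK // -PoszD.
have -> : k.*2.+1 %% 2 = 1 by rewrite -muln2 -addn1 modnMDl.
rewrite /nif /=; have -> : k.*2.+1 %/ 2 = k by rewrite -muln2 -addn1 divnMDl // addn0.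
by rewrite NegzE; lia.
Qed.

Lemma stackNE N (S : nat -> 'I_tau) :
  (forall k, k < 2 * R + 4 -> digit tau N k = S k) ->
  stackN R b R tau N <-> valid_stack R tile_letter FY S.
Proof.
move=> hS; pose g := code_pair (code_pair code_int code_int) (@code_letter B).
have cell p c : p \in FY -> c \in p -> cellN b R tau N (g c) =
    (tile_letter (S (absz (R%:Z + c.1.2)%R).+1) (absz (R%:Z + c.1.1)%R) == c.2).
  move=> pF cp; have [c1 c2] := patterns_bound pF cp.
  rewrite /cellN /g /code_pair !(nfstE, nsndE) !posNE // hS; last first.
    by move: c2; move: (R) (c.1.2) => R' z; lia.
  by rewrite -tile_letterE (inj_eq (@code_letter_inj B)).
split.
  move=> /bforallP h p pF all.
  have iF : index p FY < size FY by rewrite index_mem.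
  have := h _ (leq_trans iF (size_leq_code (code_seq g) _)).
  rewrite /R cdrop_eq0 leqNgt iF /= (cnthE _ [::]) // nth_index // => /negP; apply.
  apply/bforallP => k _; rewrite cdrop_eq0; case: leqP => //= kp.
  case: p pF {iF h} all kp => // c0 p pF all kp.
  by rewrite (cnthE _ c0) // (cell _ _ pF) ?mem_nth //; apply/eqP/all/mem_nth.
move=> val; apply/bforallP => i _; rewrite {1}/R cdrop_eq0; case: leqP => //= iF.
rewrite /R (cnthE _ [::]) //; have pF := mem_nth [::] iF.
move: (nth _ _ _) pF => p pF; apply/negP => /bforallP h; apply: (val p pF) => c cp.
have ip : index c p < size p by rewrite index_mem.
have := h _ (leq_trans ip (size_leq_code _ _)).
by rewrite cdrop_eq0 leqNgt ip /= (cnthE _ c) // nth_index // (cell _ _ pF) // => /eqP.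
Qed.

Let l := (2 * R + 3) * n.

Lemma goodNE u : goodN R a b R tau m n D u <->
  exists j phi S, reads R tile_letter FY m n tab
    (fun y => letter a0 (digit a u y)) j phi S.
Proof.
have /and4P[m1 n0 _ _] := tabP.
have blk y phi : y < l -> phi < n -> (y + phi) %/ n < 2 * R + 4.
  by move=> yl pn; rewrite ltn_divLR //; move: yl; rewrite /l; nia.
split.
  move=> /bexistsP[j jm /bexistsP[phi pn /bexistsP[N Nt /andP[st /bforallP h]]]].
  have tau0 : 0 < tau.
    by move: (leq_ltn_trans (leq0n _) Nt); rewrite expn_gt0 addnC orbF.
  exists j, phi, (fun k => Ordinal (digit_lt N k tau0)); split=> //.
    exact: (stackNE (N := N) _).1 st.
  by move=> y yl; rewrite /tab /=; congr letter; apply/eqP/h.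
move=> [j [phi [S [jm pn val h]]]].
apply/bexistsP; exists j => //; apply/bexistsP; exists phi => //.
have St k : k < 2 * R + 4 -> S k < tau by [].
apply/bexistsP; exists (undigits tau (2 * R + 4) (fun k => S k)).
  exact: undigits_lt.
have dS k : k < 2 * R + 4 -> digit tau (undigits tau (2 * R + 4) (fun k => S k)) k = S k.
  by move=> kR; rewrite undigitsK.
apply/andP; split; first exact/(stackNE dS).
apply/bforallP => y yl; rewrite dS ?blk //.
have /(congr1 (@code_letter A)) := h y yl.
by rewrite !letterK ?digit_lt // => ->.
Qed.

Definition word_of (u : nat) : seq A := mkseq (fun y => letter a0 (digit a u y)) l.

(** The list is reversed because [badwordsN] adds the words at the front, in increasing order of
    [u]. *)
Definition bad_words : seq (seq A) :=
  [seq word_of u | u <- rev (iota 0 (a ^ l)) & ~~ goodN R a b R tau m n D u].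

Lemma code_bad_words : badwordsN R a b R tau m n D = code_words bad_words.
Proof.
have wordE u : wordN a l u = code_seq (@code_letter A) (word_of u).
  rewrite /wordN.
  suff h i : i <= l -> iteri i (fun i acc => (npair (digit a u (l - i.+1)) acc).+1) 0 =
      code_seq (@code_letter A) (drop (l - i) (word_of u)).
    by rewrite h // subnn drop0.
  elim: i => [|i IH] il; first by rewrite subn0 drop_oversize // size_mkseq.
  rewrite /= IH 1?ltnW // [in RHS](drop_nth a0); last by rewrite size_mkseq; lia.
  rewrite /= nth_mkseq; last by lia.
  by rewrite letterK ?digit_lt // -subSn // subSS.
rewrite /badwordsN /bad_words -/l; elim: (a ^ l) => [|k IH] //.
rewrite -{2}[k.+1]addn1 iotaD rev_cat /= add0n /nif IH.
by case: goodN => //=; rewrite wordE.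
Qed.

(** Membership in [V] is a condition on each window of length [l] separately. *)
Lemma sft1_bad_words : sft1 bad_words = V.
Proof.
apply/seteqP; split=> x h.
  move=> y0; pose u := undigits a l (fun k => code_letter (x (y0 + k%:Z)%R)).
  have du k : k < l -> letter a0 (digit a u k) = x (y0 + k%:Z)%R.
    move=> kl; rewrite undigitsK ?code_letterK // => i _; exact: code_letter_lt.
  have [gu|bu] := boolP (goodN R a b R tau m n D u).
    have /goodNE[j [phi [S [jm pn val hS]]]] := gu.
    by exists j, phi, S; split=> // y yl; rewrite -hS // du.
  have wF : word_of u \in bad_words.
    apply/mapP; exists u => //; rewrite mem_filter bu mem_rev mem_iota add0n.
    by apply: undigits_lt => i _; exact: code_letter_lt.
  case: (h _ y0 wF); rewrite /word_at size_mkseq.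
  by apply/eq_in_map => k; rewrite mem_iota add0n => kl; rewrite du.
move=> w i /mapP[u]; rewrite mem_filter => /andP[/negP bu _] -> e; apply: bu.
have du k : k < l -> letter a0 (digit a u k) = x (i + k%:Z)%R.
  move=> kl; move: e; rewrite /word_at size_mkseq => /(congr1 (fun s => nth a0 s k)).
  by rewrite !nth_mkseq.
apply/goodNE; have [j [phi [S [jm pn val hS]]]] := h i.
by exists j, phi, S; split=> // y yl; rewrite du // hS.
Qed.

End FromTable.

(** The table of [not_D_table] concerns Rauzy edges, the search tests allowed pairs; on letters
    lying on closed walks the two coincide. *)
Lemma searchN_sat : length2 FH -> ~ condition_D (rauzy_edge (sft1 FH)) ->
  exists z, searchN (code_input FH FY) z.
Proof.
move=> FH2 nD; pose ER : rel A := fun u v => `[< rauzy_edge (sft1 FH) u v >].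
have nD' : ~ condition_D (fun u v => ER u v).
  suff -> : (fun u v : A => is_true (ER u v)) = rauzy_edge (sft1 FH) by [].
  by apply/funext => u; apply/funext => v; apply/propext; split=> /asboolP.
have [m [n [F [m1 n0 sy tr cyc]]]] := not_D_table
  (fun t : 'I_tau => mkseq (fun x => digit b t x.+1) (2 * R))
  (fun t : 'I_tau => mkseq (fun x => digit b t x) (2 * R)) nD'.
have EE r i t r' i' t' : i < m -> i' < m ->
    ER (F r i t) (F r' i' t') = E (F r i t) (F r' i' t').
  move=> im im'; apply/idP/idP; first exact: rauzy_allowed.
  have [k wk] := cyc r i t im; have [k' wk'] := cyc r' i' t' im'.
  exact: allowed_rauzy wk wk'.
(* The default is met only when there is no tile. *)
pose f idx := if insub (idx %% tau) is Some t then
  code_letter (F (idx %/ tau %/ m) (idx %/ tau %% m) t) else 0.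
have fa idx : f idx < a by rewrite /f; case: insub => // t; exact: code_letter_lt.
pose D := undigits a (n * m * tau) f.
have tabE r i (t : 'I_tau) : r < n -> i < m -> tableN a m tau D r i t = code_letter (F r i t).
  move=> rn im; rewrite /tableN undigitsK //; last first.
    by do 2 apply: mulD_ltn => //.
  have tau0 := leq_ltn_trans (leq0n t) (ltn_ord t).
  have m0 : 0 < m by apply: ltnW.
  have e1 : ((r * m + i) * tau + t) %/ tau = r * m + i.
    by rewrite divnMDl // divn_small // addn0.
  have e2 : (r * m + i) %/ m = r by rewrite divnMDl // divn_small // addn0.
  have e3 : (r * m + i) %% m = i by rewrite modnMDl modn_small.
  by rewrite /f e1 e2 e3 modnMDl modn_small // valK.
exists (npair m (npair n D)); rewrite /searchN /tilesN /inA /inB /inFH /inFY.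
rewrite !(nfstE, nsndE) -/R -/tau -/a -/b -/cH; apply/and4P; split=> //.
  apply/bforallP => i im; apply/bforallP => j jm; apply/bforallP => psi psin.
  rewrite -[_ && _]xpair_eqE; case: (boolP (_ == _)) => //= ne.
  have [r rn h] := sy i j psi im jm psin ne; apply/bexistsP; exists r => //.
  apply/bforallP => t tt; apply/bforallP => t' tt'.
  rewrite (tabE r i (Ordinal tt)) // (tabE _ j (Ordinal tt')) ?ltn_mod //.
  by rewrite edgeNE -[allowed _ _ _]EE // h.
apply/bforallP => i im; apply/bforallP => t tt; apply/bforallP => t' tt'.
have i1m : i.+1 %% m < m by rewrite ltn_mod; lia.
have := tr i (Ordinal tt) (Ordinal tt') im; set P := (X in X <-> _); set Q := (X in _ <-> X).
set p := bforall _ _; set q := _ || _ => PQ.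
have pP : p <-> P.
  have e r : r < n -> edgeN cH (tableN a m tau D r i t)
      (tableN a m tau D r (i.+1 %% m) t') =
      ER (F r i (Ordinal tt)) (F r (i.+1 %% m) (Ordinal tt')).
    by move=> rn; rewrite EE // /E -edgeNE -!tabE.
  by split=> [/bforallP h r rn|h]; [rewrite -e // h|apply/bforallP => r rn; rewrite e // h].
have qQ : q <-> Q.
  rewrite /q /Q; case: eqP => im1 /=; last first.
    by split=> [/eqP e|/(congr1 val)/=->//]; exact: val_inj.
  rewrite orbF; split=> [/bforallP h|h].
    by apply/eq_in_map => x; rewrite mem_iota add0n => xR; apply/eqP/h.
  apply/bforallP => x xR; apply/eqP; move/(congr1 (fun s => nth 0 s x)): h.
  by rewrite !nth_mkseq.
by apply/eqP; apply/idP/idP => h; [apply/qQ/PQ/pP|apply/pP/PQ/qQ].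
Qed.

End Assembly.

Lemma computable_root : exists c : recfun,
   forall (A : finType) (FH : seq (seq A)),
     length2 FH -> ~ condition_D (rauzy_edge (sft1 FH)) ->
   forall (B : finType) (FY : seq (pattern B)),
   exists (m n : nat) (FV : seq (seq A)),
     [/\ computes c (code_input FH FY) (code_output m n FV),
         (0 < m)%N, (0 < n)%N &
         is_root m n (combined (sft1 FH) (sft1 FV)) (sft2 FY)].
Proof.
have [c hc] := root_program; exists c => A FH FH2 nD B FY.
have [a0 _|A0] := pickP A; last first.
  (* Over an empty alphabet there are no components, and condition D holds vacuously. *)
  by case: nD; constructor 1 => S [[v _] _ _]; have := A0 v.
have exz := searchN_sat FY a0 FH2 nD.
(* The unbounded search returns the least solution. *)
case: (ex_minnP exz) => z sz zmin.
have {}hc := hc _ _ sz (fun i iz => ltac:(by apply/negP => /zmin; rewrite leqNgt iz)).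
move: sz hc; rewrite /searchN /outputN /tilesN /inA /inB /inFH /inFY.
rewrite /code_input !(nfstE, nsndE).
move: (nfst z) (nfst (nsnd z)) (nsnd (nsnd z)) => m n D tabP hc.
have /and4P[m1 n0 _ _] := tabP.
exists m, n, (bad_words FY a0 m n D); split=> //.
- by move: hc; rewrite (code_bad_words a0 tabP).
- exact: ltnW.
- by rewrite (sft1_bad_words a0 tabP); exact: tab_root.
Qed.

Theorem theorem4p1 :
  (forall (A : finType) (H : set (int -> A)),
     nearest_neighbor H -> ~ condition_D (rauzy_edge H) ->
   forall (B : finType) (Y : set (conf2 B)), is_sft2 Y ->
   exists2 V : set (int -> A), is_sft1 V &
   exists m n : nat,
     [/\ (0 < m)%N, (0 < n)%N & is_root m n (combined H V) Y]) /\
  (exists c : recfun,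
   forall (A : finType) (FH : seq (seq A)),
     length2 FH -> ~ condition_D (rauzy_edge (sft1 FH)) ->
   forall (B : finType) (FY : seq (pattern B)),
   exists (m n : nat) (FV : seq (seq A)),
     [/\ computes c (code_input FH FY) (code_output m n FV),
         (0 < m)%N, (0 < n)%N &
         is_root m n (combined (sft1 FH) (sft1 FV)) (sft2 FY)]).
Proof.
split; last exact: computable_root.
move=> A H [FH FH2 ->] nD B Y [FY ->]; have [c h] := computable_root.
have [m [n [FV [_ m0 n0 root]]]] := h A FH FH2 nD B FY.
by exists (sft1 FV); [exists FV|exists m, n].
Qed.
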